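(* Let $K$ and $L$ be two Hopf subalgebras of a semisimple Hopf algebra $H$ over $k$. For any finite dimensional left $K$-module $M$ there is a canonical epimorphism of $L$-modules $$\pi_M:\ \bigoplus_{C\in L\backslash H/K} L\otimes_{L\cap {}^CK}{}^CM\ \longrightarrow\ (H\otimes_KM)\big\downarrow^H_L ,$$ given on components by $l\otimes_{L\cap{}^CK}v\mapsto lv$ for $l\in L$ and $v\in{}^CM$ (that is, $l\otimes(x\otimes_K m)\mapsto lx\otimes_K m$ for $x\in CK$, $m\in M$). Here ${}^CM:=CK\otimes_KM$.
   Context: $k$ is an algebraically closed field of characteristic zero; $H$ is a semisimple (hence finite dimensional and cosemisimple) Hopf algebra over $k$ with counit $\epsilon$. For subspaces $X,Y\subseteq H$, $XY$ denotes the linear span of all products $xy$. Irreducible characters of $H^*$ are viewed as elements of $H$; they correspond bijectively to simple subcoalgebras: a simple subcoalgebra $C$ with comatrix basis $(x_{ij})$, $\Delta(x_{ij})=\sum_l x_{il}\otimes x_{lj}$, corresponds to $c=\sum_i x_{ii}$; one writes $C=C_c$. $\mathrm{Irr}(H^* )$ is the set of these characters. $\Lambda_K\in K$ is the integral of $K$ with $\epsilon(\Lambda_K)=1$. Double cosets: the relation $C\sim D$ iff $C\subseteq LDK$ is an equivalence relation on simple subcoalgebras of $H$, with $C\sim D$ iff $LCK=LDK$. $L\backslash H/K$ is the set of double cosets $LCK$; a sum over $C\in L\backslash H/K$ runs over one representative simple subcoalgebra $C$ per equivalence class. Conjugate Hopf subalgebra: for a simple subcoalgebra $C$ with character $c$,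 ${}^CK:=\bigoplus_{d}C_d$, the sum over all $d\in\mathrm{Irr}(H^* )$ with $dc\Lambda_K=\epsilon(d)c\Lambda_K$. It is a Hopf subalgebra of $H$, and $CK$ is stable under left multiplication by ${}^CK$, so ${}^CM=CK\otimes_KM$ is a left ${}^CK$-module by left multiplication. *)

(* Defs.v *)
From HB Require Import structures.
From mathcomp Require Import all_boot all_order all_algebra all_field.
From mathcomp Require Import boolp.

Set Implicit Arguments.
Unset Strict Implicit.
Unset Printing Implicit Defensive.

Import GRing.Theory VectorInternalTheory.
Local Open Scope ring_scope.

(* The linear span of an arbitrary set of vectors: the smallest subspace       *)
(* containing it.                                                              *)
Lemma span_set_subproof (k : fieldType) (V : vectType k) (P : V -> Prop) :
  { W : {vspace V} | (forall v, P v -> v \in W) /\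
      forall W' : {vspace V}, (forall v, P v -> v \in W') -> (W <= W')%VS }.
Proof.
apply: cid.
pose Q (n : nat) := `[< exists2 W : {vspace V},
  (forall v, P v -> v \in W) & \dim W = n >].
have exQ : exists n, Q n.
  by exists (\dim {: V}); apply/asboolP; exists fullv => // v _; rewrite memvf.
case: (ex_minnP exQ) => n /asboolP [W PW dW] nmin.
exists W; split=> // W' PW'.
have /nmin : Q (\dim (W :&: W')).
  apply/asboolP; exists (W :&: W')%VS => // v Pv.
  by rewrite memv_cap PW ?PW'.
rewrite -dW => le_d.
have /eqP <- : (W :&: W' == W)%VS by rewrite eqEdim capvSl.
exact: capvSr.
Qed.

Definition span_set (k : fieldType) (V : vectType k) (P : V -> Prop) :
  {vspace V} := sval (span_set_subproof P).

Lemma mem_span_set (k : fieldType) (V : vectType k) (P : V -> Prop) v :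
  P v -> v \in span_set P.
Proof. by rewrite /span_set; case: span_set_subproof => W /= [PW _] /PW. Qed.

Lemma span_set_sub (k : fieldType) (V : vectType k) (P : V -> Prop)
    (W : {vspace V}) :
  (forall v, P v -> v \in W) -> (span_set P <= W)%VS.
Proof. by rewrite /span_set; case: span_set_subproof => W0 /= [_ +]; apply. Qed.

(* The quotient space V / W, realised on a complement of W; [qproj] is the     *)
(* canonical projection.                                                       *)
Definition quotv (k : fieldType) (V : vectType k) (W : {vspace V}) :
  vectType k := subvs_of (W^C)%VS.

Definition qproj (k : fieldType) (V : vectType k) (W : {vspace V}) (v : V) :
  quotv W := vsproj (W^C)%VS (v - projv W v).

Section QuotientFacts.
Variables (k : fieldType) (V : vectType k) (W : {vspace V}).

Lemma qproj_is_linear : linear (@qproj k V W).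
Proof.
move=> a u v; rewrite /qproj -linearP; congr (vsproj _ _).
by rewrite linearP scalerBr addrACA opprD.
Qed.

HB.instance Definition _ := GRing.isSemilinear.Build k V (quotv W) _
  (@qproj k V W) (GRing.semilinear_linear qproj_is_linear).

Lemma qproj_eq0 v : (qproj W v == 0) = (v \in W).
Proof.
rewrite -(inj_eq val_inj) /= vsprojK ?memv_projC // subr_eq0.
by apply/eqP/idP => [->|/projv_id->//]; exact: memv_proj.
Qed.

Lemma qproj_eq u v : (qproj W u = qproj W v) <-> (u - v \in W).
Proof.
by rewrite -qproj_eq0 linearB subr_eq0 /=; split=> /eqP.
Qed.

Lemma qproj_val (z : quotv W) : qproj W (vsval z) = z.
Proof.
have zW := subvsP z; apply/val_inj => /=; rewrite vsprojK ?memv_projC //.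
have : projv W (vsval z) = 0 by apply/eqP; rewrite -memv_ker lker_proj.
by move->; rewrite subr0.
Qed.

Lemma qproj_repr v : v - vsval (qproj W v) \in W.
Proof. by rewrite -qproj_eq0 linearB /= qproj_val subrr. Qed.

End QuotientFacts.

Definition qmap (k : fieldType) (V : vectType k) (W : {vspace V})
  (f : V -> V) (z : quotv W) : quotv W := qproj W (f (vsval z)).

(* U (x) V over the base field, in coordinates: [tens u v] is the rank one     *)
(* matrix of the products of the coordinates of u and v.  [tlift b] is the     *)
(* map out of U (x) V induced by the bilinear map b, so that Sweedler's        *)
(* \sum b(h_1, h_2) is [tlift b (comul h)].                                    *)
Definition tensor (k : fieldType) (U V : vectType k) : vectType k :=
  'M[k]_(dim U, dim V).

Definition tens (k : fieldType) (U V : vectType k) (u : U) (v : V) :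
  tensor U V := (v2r u)^T *m v2r v.

Definition tlift (k : fieldType) (U V : vectType k) (X : lmodType k)
    (b : U -> V -> X) (t : tensor U V) : X :=
  \sum_(i < dim U) \sum_(j < dim V)
     (t : 'M_(_, _)) i j *: b (r2v (delta_mx 0 i)) (r2v (delta_mx 0 j)).

Definition tensv (k : fieldType) (U V : vectType k)
    (A : {vspace U}) (B : {vspace V}) : {vspace tensor U V} :=
  span_set (fun t => exists a b, [/\ a \in A, b \in B & t = tens a b]).

Section TensorFacts.
Variables (k : fieldType) (U V : vectType k).

Lemma tens_linearl (v : V) : linear (fun u : U => tens u v).
Proof.
by move=> a u u'; rewrite /tens !linearP /= mulmxDl -scalemxAl.
Qed.

Lemma tens_linearr (u : U) : linear (tens u : V -> _).
Proof. by move=> a v v'; rewrite /tens !linearP. Qed.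

Lemma tlift_is_linear (X : lmodType k) (b : U -> V -> X) : linear (tlift b).
Proof.
move=> a s t; rewrite /tlift scaler_sumr -big_split; apply: eq_bigr => i _ /=.
rewrite scaler_sumr -big_split; apply: eq_bigr => j _ /=.
by rewrite !mxE scalerDl scalerA.
Qed.

HB.instance Definition _ (X : lmodType k) (b : U -> V -> X) :=
  GRing.isSemilinear.Build k (tensor U V) X _ (tlift b)
    (GRing.semilinear_linear (tlift_is_linear b)).

Lemma r2v_sum (T : vectType k) (v : T) :
  v = \sum_(i < dim T) v2r v 0 i *: r2v (delta_mx 0 i).
Proof.
rewrite -[LHS]v2rK [v2r v]row_sum_delta linear_sum.
by apply: eq_bigr => i _; rewrite -row_sum_delta linearZ.
Qed.

Lemma tlift_tens (X : lmodType k) (b : U -> V -> X) u v :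
  (forall y, linear (b^~ y)) -> (forall x, linear (b x)) ->
  tlift b (tens u v) = b u v.
Proof.
move=> bl br.
pose fl y : {linear U -> X} := HB.pack (b^~ y)
  (GRing.isSemilinear.Build k U X _ (b^~ y) (GRing.semilinear_linear (bl y))).
pose fr x : {linear V -> X} := HB.pack (b x)
  (GRing.isSemilinear.Build k V X _ (b x) (GRing.semilinear_linear (br x))).
rewrite {2}(r2v_sum u) -[b _ v]/(fl v _) linear_sum; apply: eq_bigr => i _.
rewrite linearZ /= {2}(r2v_sum v) -[b _ (\sum_(_ < _) _)]/(fr _ _).
rewrite linear_sum scaler_sumr; apply: eq_bigr => j _.
by rewrite linearZ /= scalerA /tens mxE big_ord1 mxE.
Qed.

End TensorFacts.

Record hopf (k : fieldType) (H : falgType k) := Hopf {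
  comul : {linear H -> tensor H H};
  counit : {scalar H};
  antipode : {linear H -> H};
  comul_coassoc : forall h,
    tlift (fun x y => tlift (fun a b => tens a (tens b y)) (comul x)) (comul h)
    = tlift (fun x y => tens x (comul y)) (comul h);
  counitl : forall h, tlift (fun x y => counit x *: y) (comul h) = h;
  counitr : forall h, tlift (fun x y => counit y *: x) (comul h) = h;
  comul1 : comul 1 = tens 1 1;
  comulM : forall g h, comul (g * h) =
    tlift (fun a b => tlift (fun c d => tens (a * c) (b * d)) (comul h))
      (comul g);
  counit1 : counit 1 = 1;
  counitM : forall g h, counit (g * h) = counit g * counit h;
  antipodel : forall h,
    tlift (fun x y => antipode x * y) (comul h) = (counit h)%:A;
  antipoder : forall h,
    tlift (fun x y => x * antipode y) (comul h) = (counit h)%:A }.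

Definition left_ideal (k : fieldType) (H : falgType k) (J : {vspace H}) :=
  ({: H} * J <= J)%VS.

Definition semisimple (k : fieldType) (H : falgType k) :=
  forall J : {vspace H}, left_ideal J ->
    exists J' : {vspace H},
      [/\ left_ideal J', (J + J')%VS = fullv & (J :&: J')%VS = 0%VS].

Definition lmodule_action (k : fieldType) (H : falgType k) (A : {aspace H})
    (X : lmodType k) (act : subvs_of A -> X -> X) :=
  [/\ forall a, linear (act a), forall x, linear (act^~ x),
      forall x, act 1 x = x &
      forall a b x, act (a * b) x = act a (act b x)].

Section Coalgebra.
Variables (k : fieldType) (H : falgType k) (hH : hopf H).

(* The unit of the algebra structure of [A : {aspace H}] may differ from 1.    *)
Definition hopf_subalgebra (A : {aspace H}) :=
  [/\ 1 \in A, forall a, a \in A -> comul hH a \in tensv A A &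
      forall a, a \in A -> antipode hH a \in A].

Definition subcoalgebra (C : {vspace H}) :=
  forall c, c \in C -> comul hH c \in tensv C C.

Definition simple_subcoalgebra (C : {vspace H}) :=
  [/\ subcoalgebra C, C != 0%VS &
      forall D : {vspace H}, subcoalgebra D -> (D <= C)%VS ->
        D = 0%VS \/ D = C].

Definition comatrix_basis (C : {vspace H}) (n : nat) (x : 'M[H]_n) :=
  basis_of C [seq x p.1 p.2 | p : 'I_n * 'I_n] /\
  forall i j, comul hH (x i j) = \sum_l tens (x i l) (x l j).

(* [c] is the irreducible character of H^*, seen in H, with C_c = C.           *)
Definition is_character (C : {vspace H}) (c : H) :=
  simple_subcoalgebra C /\
  exists (n : nat) (x : 'M[H]_n), comatrix_basis C x /\ c = \sum_i x i i.

Definition is_unital_integral (K : {vspace H}) (Lambda : H) :=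
  [/\ Lambda \in K, counit hH Lambda = 1 &
      forall a, a \in K -> a * Lambda = counit hH a *: Lambda /\
                           Lambda * a = counit hH a *: Lambda].

Definition conj_hopf (K C : {vspace H}) : {vspace H} :=
  span_set (fun h => exists c Lambda D d,
    [/\ is_character C c, is_unital_integral K Lambda, is_character D d,
        d * (c * Lambda) = counit hH d *: (c * Lambda) & h \in D]).

(* The equivalence relation C ~ D defining double cosets.                      *)
Definition dcoset_rel (L K C D : {vspace H}) := (C <= L * D * K)%VS.

Definition dcoset_reps (L K : {vspace H}) (I : finType) (C : I -> {vspace H}) :=
  [/\ forall i, simple_subcoalgebra (C i),
      forall i j, dcoset_rel L K (C i) (C j) -> i = j &
      forall D, simple_subcoalgebra D -> exists i, dcoset_rel L K D (C i)].

End Coalgebra.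

(* Tensor products over subalgebras are quotients of tensor products over k by *)
(* the span of the balancing relators.                                         *)
Section Induction.
Variables (k : fieldType) (H : falgType k) (hH : hopf H).
Variables (K L : {aspace H}) (M : vectType k) (act : subvs_of K -> M -> M).

(* H (x)_K M *)
Definition induced_rel : {vspace tensor H M} := span_set (fun t =>
  exists (h : H) (a : subvs_of K) (m : M),
    t = tens (h * vsval a) m - tens h (act a m)).

Definition induced : vectType k := quotv induced_rel.

Definition induced_tens (h : H) (m : M) : induced :=
  qproj induced_rel (tens h m).

(* The restriction to L of the H-module H (x)_K M.                             *)
Definition induced_lact (l : subvs_of L) : induced -> induced :=
  qmap (tlift (fun h m => tens (vsval l * h) m)).

(* ^C M = CK (x)_K M *)
Definition conjM_rel (C : {vspace H}) : {vspace tensor (subvs_of (C * K)) M} :=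
  span_set (fun t => exists (x y : subvs_of (C * K)) (a : subvs_of K) (m : M),
    vsval y = vsval x * vsval a /\ t = tens y m - tens x (act a m)).

Definition conjM (C : {vspace H}) : vectType k := quotv (conjM_rel C).

Definition conjM_tens (C : {vspace H}) (x : subvs_of (C * K)) (m : M) :
  conjM C := qproj (conjM_rel C) (tens x m).

(* L (x)_(L \cap ^C K) ^C M.  As ^C K stabilises CK and acts on ^C M by left    *)
(* multiplication, a * (x (x) m) is y (x) m, where y in CK equals a * x; these *)
(* elements x (x) m span ^C M.                                                 *)
Definition component_rel (C : {vspace H}) :
    {vspace tensor (subvs_of L) (conjM C)} :=
  span_set (fun t =>
    exists (l a : subvs_of L) (x y : subvs_of (C * K)) (m : M),
    [/\ vsval a \in conj_hopf hH K C, vsval y = vsval a * vsval x &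
        t = tens (l * a) (conjM_tens x m) - tens l (conjM_tens y m)]).

Definition component (C : {vspace H}) : vectType k := quotv (component_rel C).

Definition component_tens (C : {vspace H}) (l : subvs_of L) (v : conjM C) :
  component C := qproj (component_rel C) (tens l v).

Definition component_lact (C : {vspace H}) (l : subvs_of L) :
    component C -> component C :=
  qmap (tlift (fun l' v => tens (l * l') v)).

End Induction.

Section DirectSum.
Variables (k : fieldType) (I : finType) (T : I -> vectType k).

Definition dsum : Type := {dffun forall i, T i}.

HB.instance Definition _ := Choice.on dsum.

Definition dsum0 : dsum := [ffun i => 0].
Definition dsum_opp (f : dsum) : dsum := [ffun i => - f i].
Definition dsum_add (f g : dsum) : dsum := [ffun i => f i + g i].
Definition dsum_scale (a : k) (f : dsum) : dsum := [ffun i => a *: f i].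

Fact dsum_addA : associative dsum_add.
Proof. by move=> f g h; apply/ffunP=> i; rewrite !ffunE addrA. Qed.
Fact dsum_addC : commutative dsum_add.
Proof. by move=> f g; apply/ffunP=> i; rewrite !ffunE addrC. Qed.
Fact dsum_add0 : left_id dsum0 dsum_add.
Proof. by move=> f; apply/ffunP=> i; rewrite !ffunE add0r. Qed.
Fact dsum_addN : left_inverse dsum0 dsum_opp dsum_add.
Proof. by move=> f; apply/ffunP=> i; rewrite !ffunE addNr. Qed.

HB.instance Definition _ := GRing.isZmodule.Build dsum
  dsum_addA dsum_addC dsum_add0 dsum_addN.

Fact dsum_scaleA a b f : dsum_scale a (dsum_scale b f) = dsum_scale (a * b) f.
Proof. by apply/ffunP=> i; rewrite !ffunE scalerA. Qed.
Fact dsum_scale1 : left_id 1 dsum_scale.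
Proof. by move=> f; apply/ffunP=> i; rewrite !ffunE scale1r. Qed.
Fact dsum_scaleDr : right_distributive dsum_scale +%R.
Proof. by move=> a f g; apply/ffunP=> i; rewrite !ffunE scalerDr. Qed.
Fact dsum_scaleDl f : {morph dsum_scale^~ f : a b / a + b}.
Proof. by move=> a b; apply/ffunP=> i; rewrite !ffunE scalerDl. Qed.

HB.instance Definition _ := GRing.Zmodule_isLmodule.Build k dsum
  dsum_scaleA dsum_scale1 dsum_scaleDr dsum_scaleDl.

Definition dsum_in (i : I) (t : T i) : dsum :=
  finfun (dfwith (fun j : I => 0 : T j) t).

Definition dsum_act (A : Type) (act : forall i, A -> T i -> T i) (a : A)
  (f : dsum) : dsum := [ffun i => act i a (f i)].

End DirectSum.

Arguments dsum_in {k I} T i t.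

Section ActionFacts.
Variables (k : fieldType).

Lemma span_set_stable (V : vectType k) (P : V -> Prop) (f : {linear V -> V}) :
  (forall v, P v -> f v \in span_set P) ->
  forall v, v \in span_set P -> f v \in span_set P.
Proof.
move=> fP v vP; have : v \in (linfun f @^-1: span_set P)%VS.
  apply: (subvP _ v vP); apply: span_set_sub => u Pu.
  by rewrite -memv_preim lfunE fP.
by rewrite -memv_preim lfunE.
Qed.

Lemma qmapE (V : vectType k) (W : {vspace V}) (f : {linear V -> V}) v :
  (forall u, u \in W -> f u \in W) -> qmap f (qproj W v) = qproj W (f v).
Proof.
move=> fW; apply/qproj_eq; rewrite -linearB fW //.
by rewrite -opprB rpredN qproj_repr.
Qed.

Variables (U V : vectType k).
Local Notation tmapl f := (tlift (fun (x : U) (y : V) => tens (f x) y)).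

Lemma tmapl_tens (f : {linear U -> U}) u v : tmapl f (tens u v) = tens (f u) v.
Proof.
apply: tlift_tens => [y a x x'|x]; last exact: tens_linearr.
by rewrite linearP tens_linearl.
Qed.

Lemma tensor_sum (t : tensor U V) : t = tlift (@tens k U V) t.
Proof.
rewrite /tlift [LHS]matrix_sum_delta; apply: eq_bigr => i _.
apply: eq_bigr => j _; rewrite /tens !r2vK; congr (_ *: _).
apply/matrixP=> p q; rewrite !mxE big_ord1 !mxE !eqxx /=.
by case: (p == i); case: (q == j); rewrite ?mulr1 ?mulr0 ?mul0r.
Qed.

Lemma tmapl_id t : tmapl id t = t.
Proof. by rewrite [RHS]tensor_sum. Qed.

Lemma tmapl_comp (f g : {linear U -> U}) t :
  tmapl (f \o g) t = tmapl f (tmapl g t).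
Proof.
rewrite [X in tmapl f X]/tlift linear_sum; apply: eq_bigr => i _; rewrite linear_sum.
by apply: eq_bigr => j _; rewrite linearZ /= tmapl_tens.
Qed.

Lemma tmapl_linear a (f g h : U -> U) t :
  (forall x, h x = a *: f x + g x) -> tmapl h t = a *: tmapl f t + tmapl g t.
Proof.
move=> hE; rewrite /tlift scaler_sumr -big_split; apply: eq_bigr => i _ /=.
rewrite scaler_sumr -big_split; apply: eq_bigr => j _ /=.
by rewrite hE tens_linearl scalerDr scalerA mulrC -scalerA.
Qed.

End ActionFacts.

Section MultiplicationFacts.
Variables (k : fieldType) (A : falgType k) (V : vectType k).

Lemma tmull_tens (g : A) u (v : V) :
  tlift (fun x y => tens (g * x) y) (tens u v) = tens (g * u) v.
Proof. exact: (tmapl_tens (g \*o idfun)). Qed.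

Lemma tmullA (g h : A) (t : tensor A V) :
  tlift (fun x y => tens (g * h * x) y) t =
  tlift (fun x y => tens (g * x) y) (tlift (fun x y => tens (h * x) y) t).
Proof.
rewrite -[RHS](tmapl_comp (g \*o idfun) (h \*o idfun)).
by apply: eq_bigr => i _; apply: eq_bigr => j _; rewrite /= mulrA.
Qed.

End MultiplicationFacts.

Section Actions.
Variables (k : fieldType) (H : falgType k) (hH : hopf H).
Variables (K L : {aspace H}) (M : vectType k) (act : subvs_of K -> M -> M).

Lemma induced_rel_stable (g : H) t :
  t \in induced_rel act ->
  tlift (fun h m => tens (g * h) m) t \in induced_rel act.
Proof.
apply: span_set_stable => _ [h [a [m ->]]].
rewrite linearB /= !tmull_tens mulrA; apply: mem_span_set.
by exists (g * h), a, m.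
Qed.

Lemma induced_lactE (l : subvs_of L) h m :
  induced_lact l (induced_tens act h m) = induced_tens act (vsval l * h) m.
Proof.
rewrite /induced_lact /induced_tens qmapE; last exact: induced_rel_stable.
by rewrite /= tmull_tens.
Qed.

Lemma induced_lactP : 1 \in L -> lmodule_action (@induced_lact _ _ K L M act).
Proof.
rewrite -algid_eq1 => /eqP L1; split=> [a b x y|x c a b|x|a b x].
- by rewrite /induced_lact /qmap !linearP.
- rewrite /induced_lact /qmap -linearP; congr (qproj _ _).
  by apply: tmapl_linear => // y; rewrite linearP mulrDl scalerAl.
- rewrite /induced_lact /qmap -[RHS]qproj_val; congr (qproj _ _).
  rewrite -[RHS]tmapl_id; apply: eq_bigr => i _; apply: eq_bigr => j _.
  by rewrite /= L1 mul1r.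
rewrite /induced_lact [X in _ = qmap _ X]/qmap qmapE; last exact: induced_rel_stable.
by rewrite /= -tmullA.
Qed.

Lemma component_rel_stable C (g : subvs_of L) t :
  t \in component_rel hH L act C ->
  tlift (fun l v => tens (g * l) v) t \in component_rel hH L act C.
Proof.
apply: span_set_stable => _ [l [a [x [y [m [aC xy ->]]]]]].
rewrite linearB /= !tmull_tens mulrA; apply: mem_span_set.
by exists (g * l), a, x, y, m.
Qed.

Lemma component_lactE C (l l' : subvs_of L) (v : conjM act C) :
  component_lact l (component_tens hH l' v)
    = component_tens hH (l * l') v.
Proof.
rewrite /component_lact /component_tens qmapE; last exact: component_rel_stable.
by rewrite /= tmull_tens.
Qed.

Lemma component_lactP C :
  lmodule_action (@component_lact _ _ hH K L M act C).
Proof.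
split=> [a b x y|x c a b|x|a b x].
- by rewrite /component_lact /qmap !linearP.
- rewrite /component_lact /qmap -linearP; congr (qproj _ _).
  by apply: tmapl_linear => // y; rewrite mulrDl scalerAl.
- rewrite /component_lact /qmap -[RHS]qproj_val; congr (qproj _ _).
  rewrite -[RHS]tmapl_id; apply: eq_bigr => i _; apply: eq_bigr => j _.
  by rewrite /= mul1r.
rewrite /component_lact [X in _ = qmap _ X]/qmap qmapE; last exact: component_rel_stable.
by rewrite /= -tmullA.
Qed.

Lemma dsum_actP (I : finType) (T : I -> vectType k)
    (f : forall i, subvs_of L -> T i -> T i) :
  (forall i, lmodule_action (f i)) -> lmodule_action (X := dsum T) (dsum_act f).
Proof.
move=> fP; split=> [a b x y|x c a b|x|a b x]; apply/ffunP=> i; rewrite !ffunE;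
  by case: (fP i) => l1 l2 l3 l4; rewrite ?l1 ?l2 ?l3 ?l4.
Qed.

End Actions.

(* Main.v *)
(* Surjectivity of the Mackey map amounts to H being the sum of its simple     *)
(* subcoalgebras, i.e. to the Larson-Radford theorem that a semisimple Hopf    *)
(* algebra in characteristic zero is cosemisimple.  The functional             *)
(* t(h) = Tr(x |-> h S^2(x)) is an integral of H^*, so by Maschke it is enough *)
(* that t(1) = Tr(S^2) <> 0.  The Nakayama automorphism of the form t is S^2,  *)
(* and comparing t with the trace form of H shows that S^2 is conjugation by a *)
(* unit u; comparing t with t o S shows that S^4 is conjugation by a           *)
(* grouplike element, which has finite order.  Rescaling u by a central        *)
(* element gives v with v^n = 1 and S^2 = Ad v, whence                         *)
(*   Tr(S^2) = \sum_e tau(v e) tau(v^-1 e) / tau(e),                           *)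
(* with tau the regular trace and e running over the primitive central         *)
(* idempotents.  Here tau(v e) is a sum of n-th roots of unity and tau(v^-1 e) *)
(* is its complex conjugate after transport to algC (legitimate because the    *)
(* cyclotomic polynomial is irreducible over the rationals), so the sum can    *)
(* only vanish if every tau(v e) does; but tau(v Lambda) = eps(v) <> 0.        *)

Require Import Defs.
From HB Require Import structures.
From mathcomp Require Import all_boot all_order all_algebra all_field.
From mathcomp Require Import boolp.

Set Implicit Arguments.
Unset Strict Implicit.
Unset Printing Implicit Defensive.

Import GRing.Theory VectorInternalTheory Num.Theory.
Local Open Scope ring_scope.

(** * Bilinear maps and Sweedler calculus *)

(** The assignment l (x) (x (x) m) |-> lx (x) m respects the balancing relations by associativity
    ([conjM_mulE], [component_mapE]) and commutes with the action of L, so everything rests on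
    surjectivity. An element h (x) m is in the image as soon as h lies in the sum of the L C K
    ([mackey_map_surj]), and this sum contains every simple subcoalgebra by the choice of
    representatives. It remains to see that the simple subcoalgebras span H
    ([simple_subcoalgebra_span]).

    This is the dual of Maschke's theorem: an integral lam on H with lam(1) = 1 averages a linear
    projection onto a subcoalgebra to one that commutes with the comultiplication on both sides, and
    its kernel is a complementary subcoalgebra ([subcoalgebra_complement]). The integral is t(h) =
    Tr(x |-> h S^2(x)) divided by t(1) ([trint_integral]), so the crux is Tr(S^2) <> 0
    ([trint1_neq0]).

    The form t is nondegenerate with Nakayama automorphism S^2; compared with the symmetric regular
    trace it yields S^2 = Ad u. Radford's formula ([antipode4]) makes S^4 conjugation by a
    grouplike, of finite order by [grouplike_finite_order], and a central square root corrects u to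
    some v of finite order ([antipode2_inner]). Then [trace_lrmul] writes Tr(x |-> v x v^-1) as a
    sum over the blocks. Moved to the algebraic complex numbers by [prim_root_evalP], its terms are
    nonnegative, so a zero sum would kill the regular trace of v c for every central c
    ([trace_conj_neq0]); the integral of H is a central c for which that trace is eps(v) <> 0. *)

Section LinearFunctions.
Variables (k : fieldType).

Lemma linear_id (V : lmodType k) : linear (fun x : V => x).
Proof. by []. Qed.

Lemma linear_comp (V W : lmodType k) (X : nmodType) (s : k -> X -> X)
    (g : W -> X) (f : V -> W) :
  GRing.linear_for s g -> linear f -> GRing.linear_for s (fun x => g (f x)).
Proof. by move=> gl fl a u v; rewrite fl gl. Qed.

Lemma linear_for_linear (V : lmodType k) (X : nmodType) (s : k -> X -> X)
  (g : {linear V -> X | s}) : GRing.linear_for s g.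
Proof. exact: linearP. Qed.

Lemma linear_mull (V : lmodType k) (A : algType k) (c : A) (f : V -> A) :
  linear f -> linear (fun x => c * f x).
Proof. by move=> fl a u v; rewrite fl mulrDr scalerAr. Qed.

Lemma linear_mulr (V : lmodType k) (A : algType k) (c : A) (f : V -> A) :
  linear f -> linear (fun x => f x * c).
Proof. by move=> fl a u v; rewrite fl mulrDl scalerAl. Qed.

Lemma scalar_mull (V : lmodType k) (c : k) (f : V -> k) :
  scalar f -> scalar (fun x => c * f x).
Proof. by move=> fl a u v; rewrite fl mulrDr mulrCA. Qed.

Lemma scalar_mulr (V : lmodType k) (c : k) (f : V -> k) :
  scalar f -> scalar (fun x => f x * c).
Proof. by move=> fl a u v; rewrite fl mulrDl mulrA. Qed.

Lemma linear_scalel (V W : lmodType k) (c : k) (f : V -> W) :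
  linear f -> linear (fun x => c *: f x).
Proof. by move=> fl a u v; rewrite fl scalerDr !scalerA mulrC. Qed.

Lemma linear_scaler (V W : lmodType k) (w : W) (f : V -> k) :
  scalar f -> linear (fun x => f x *: w).
Proof. by move=> fl a u v; rewrite fl scalerDl scalerA. Qed.

Lemma linear_add (V W : lmodType k) (f g : V -> W) :
  linear f -> linear g -> linear (fun x => f x + g x).
Proof. by move=> fl gl a u v; rewrite fl gl scalerDr addrACA. Qed.

Lemma linear_opp (V W : lmodType k) (f : V -> W) :
  linear f -> linear (fun x => - f x).
Proof. by move=> fl a u v; rewrite fl opprD scalerN. Qed.

Lemma linear_tlift (V X : lmodType k) (U W : vectType k)
    (b : V -> U -> W -> X) (t : tensor U W) :
  (forall x y, linear (fun v => b v x y)) -> linear (fun v => tlift (b v) t).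
Proof.
move=> bl a u v; rewrite /tlift scaler_sumr -big_split; apply: eq_bigr => i _ /=.
rewrite scaler_sumr -big_split; apply: eq_bigr => j _ /=.
by rewrite bl scalerDr !scalerA mulrC.
Qed.

Lemma linear_funZ (V X : lmodType k) (f : V -> X) : linear f ->
  forall a x, f (a *: x) = a *: f x.
Proof.
move=> fl a x; pose g : {linear V -> X} := HB.pack f
  (GRing.isSemilinear.Build k V X _ f (GRing.semilinear_linear fl)).
exact: (linearZ_LR g).
Qed.

Lemma linear_funB (V X : lmodType k) (f : V -> X) : linear f ->
  forall x y, f (x - y) = f x - f y.
Proof.
move=> fl x y; pose g : {linear V -> X} := HB.pack f
  (GRing.isSemilinear.Build k V X _ f (GRing.semilinear_linear fl)).
exact: (linearB g).
Qed.

End LinearFunctions.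

(** Recursion on the head symbol; in each product, scaling, tensor or [tlift] the bound variable has
    to occur on one side only. Goals of another shape are left untouched, so the tactic can be run
    on all side goals of a rewrite. *)
Ltac lin := intros; cbv beta; lazymatch goal with
  | |- GRing.linear_for _ (fun x => x) => exact: linear_id
  | |- GRing.linear_for _ (fun x => @?f x * @?g x) =>
      lazymatch f with
      | fun _ => ?c => first [apply (linear_mull c (f := g)) | apply (scalar_mull c (f := g))]
      | _ => lazymatch g with fun _ => ?c =>
          first [apply (linear_mulr c (f := f)) | apply (scalar_mulr c (f := f))] end
      end; lin
  | |- GRing.linear_for _ (fun x => @?f x *: @?g x) =>
      lazymatch f with
      | fun _ => ?c => apply (linear_scalel c (f := g))
      | _ => lazymatch g with fun _ => ?c => apply (linear_scaler c (f := f)) end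
      end; lin
  | |- GRing.linear_for _ (fun x => @?f x + @?g x) =>
      apply (linear_add (f := f) (g := g)); lin
  | |- GRing.linear_for _ (fun x => - @?f x) =>
      apply (linear_opp (f := f)); lin
  | |- GRing.linear_for _ (fun x => tens (@?f x) (@?g x)) =>
      lazymatch g with
      | fun _ => ?c => apply (linear_comp (tens_linearl c) (f := f))
      | _ => lazymatch f with fun _ => ?c => apply (linear_comp (tens_linearr c) (f := g)) end
      end; lin
  | |- GRing.linear_for _ (fun x => tlift (@?b x) (@?f x)) =>
      lazymatch b with
      | fun _ => ?c => apply (linear_comp (tlift_is_linear c) (f := f))
      | _ => lazymatch f with fun _ => ?t => apply (linear_tlift (b := b) t) end
      end; lin
  | |- GRing.linear_for _ (fun x => @GRing.Linear.sort ?R ?V ?W ?s ?g (@?f x)) =>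
      apply (@linear_comp _ _ _ _ s (@GRing.Linear.sort R V W s g) f
                (linear_for_linear g)); lin
  | |- GRing.linear_for _ (fun x => ?b (@?f x) (@?g x)) =>
      lazymatch g with
      | fun _ => ?c =>
          match goal with Hb : forall y, GRing.linear_for _ _ |- _ =>
            apply (linear_comp (Hb c) (f := f)) end
      | _ => lazymatch f with fun _ => ?c =>
          match goal with
          | Hb : forall y, GRing.linear_for _ _ |- _ =>
              apply (linear_comp (Hb c) (f := g))
          | _ => apply (linear_comp (linear_for_linear (b c)) (f := g))
          end end
      end; lin
  | |- GRing.linear_for _ (fun x => ?g (@?f x)) =>
      match goal with
      | Hg : GRing.linear_for _ _ |- _ => apply (linear_comp Hg (f := f))
      | _ => apply (linear_comp (linear_for_linear g) (f := f))
      end; lin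
  | |- GRing.linear_for _ _ => first [exact: linear_for_linear | assumption]
  | |- _ => idtac
  end.

Section TensorLift.
Variables (k : fieldType).

Lemma tlift_linear (U V : vectType k) (X Y : lmodType k) (f : X -> Y)
    (b : U -> V -> X) (t : tensor U V) :
  linear f -> f (tlift b t) = tlift (fun x y => f (b x y)) t.
Proof.
move=> fl; pose g : {linear X -> Y} := HB.pack f
  (GRing.isSemilinear.Build k X Y _ f (GRing.semilinear_linear fl)).
rewrite -[f]/(g : X -> Y) linear_sum; apply: eq_bigr => i _.
by rewrite linear_sum; apply: eq_bigr => j _; rewrite linearZ.
Qed.

Lemma eq_tlift (U V : vectType k) (X : lmodType k) (b b' : U -> V -> X) t :
  b =2 b' -> tlift b t = tlift b' t.
Proof.
by move=> e; apply: eq_bigr => i _; apply: eq_bigr => j _; rewrite e.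
Qed.

Lemma tlift_sum (U V : vectType k) (X : lmodType k) (I : finType)
    (b : I -> U -> V -> X) t :
  tlift (fun x y => \sum_i b i x y) t = \sum_i tlift (b i) t.
Proof.
rewrite /tlift [RHS]exchange_big; apply: eq_bigr => p _ /=.
by rewrite [RHS]exchange_big; apply: eq_bigr => q _ /=; rewrite scaler_sumr.
Qed.

Lemma tlift_eq0 (U V : vectType k) (X : lmodType k) (b : U -> V -> X) t :
  (forall x y, b x y = 0) -> tlift b t = 0.
Proof.
by move=> b0; rewrite /tlift big1 // => i _; rewrite big1 // => j _; rewrite b0 scaler0.
Qed.

Lemma tliftB (U V : vectType k) (X : lmodType k) (b b' : U -> V -> X) t :
  tlift (fun x y => b x y - b' x y) t = tlift b t - tlift b' t.
Proof.
rewrite /tlift -sumrB; apply: eq_bigr => i _; rewrite -sumrB.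
by apply: eq_bigr => j _; rewrite scalerBr.
Qed.

Lemma tlift_scale (U V : vectType k) (X : lmodType k) a (b : U -> V -> X) t :
  a *: tlift b t = tlift (fun x y => a *: b x y) t.
Proof. by rewrite (@tlift_linear _ _ _ _ (fun z => a *: z)) //; lin. Qed.

Lemma tlift_exchange (U V U' V' : vectType k) (X : lmodType k)
    (b : U -> V -> U' -> V' -> X) s t :
  tlift (fun x y => tlift (b x y) t) s =
  tlift (fun x' y' => tlift (fun x y => b x y x' y') s) t.
Proof.
rewrite /tlift.
under eq_bigr => i _ do under eq_bigr => j _ do
  (rewrite scaler_sumr; under eq_bigr => p _ do rewrite !scaler_sumr).
under [RHS]eq_bigr => i _ do under eq_bigr => j _ do
  (rewrite scaler_sumr; under eq_bigr => p _ do rewrite !scaler_sumr).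
under eq_bigr => i _ do rewrite exchange_big /=.
rewrite exchange_big /=; apply: eq_bigr => p _.
under eq_bigr => i _ do rewrite exchange_big /=.
rewrite exchange_big /=; apply: eq_bigr => q _.
apply: eq_bigr => i _; apply: eq_bigr => j _.
by rewrite !scalerA mulrC.
Qed.

Lemma eq_tlift_basis (U V : vectType k) (X : lmodType k) (b b' : U -> V -> X) t :
  (forall i j, b (r2v (delta_mx 0 i)) (r2v (delta_mx 0 j))
             = b' (r2v (delta_mx 0 i)) (r2v (delta_mx 0 j))) ->
  tlift b t = tlift b' t.
Proof.
by move=> e; apply: eq_bigr => i _; apply: eq_bigr => j _; rewrite e.
Qed.

Lemma tlift_tens_basis (U V : vectType k) (X : lmodType k) (b : U -> V -> X) i j :
  tlift b (tens (r2v (delta_mx 0 i)) (r2v (delta_mx 0 j)))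
    = b (r2v (delta_mx 0 i)) (r2v (delta_mx 0 j)).
Proof.
rewrite /tlift (bigD1 i) //= (bigD1 j) //= [X in _ + X]big1 ?addr0 => [|p ne_pi].
  rewrite [X in _ + X]big1 ?addr0 => [|q ne_qj].
    by rewrite /tens !r2vK !mxE big_ord1 !mxE !eqxx mulr1 scale1r.
  by rewrite /tens !r2vK !mxE big_ord1 !mxE (negPf ne_qj) !eqxx mulr0 scale0r.
rewrite big1 // => q _.
by rewrite /tens !r2vK !mxE big_ord1 !mxE (negPf ne_pi) !eqxx mul0r scale0r.
Qed.

End TensorLift.

Section Sweedler.
Variables (k : fieldType) (H : falgType k) (hH : hopf H).

Notation S := (antipode hH).
Notation eps := (counit hH).
Notation Delta := (comul hH).

(* Both sides only involve the values of b on basis vectors, so no             *)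
(* trilinearity is required.                                                   *)
Lemma coassoc (X : lmodType k) (b : H -> H -> H -> X) h :
  tlift (fun x y => tlift (fun a c => b a c y) (Delta x)) (Delta h) =
  tlift (fun x y => tlift (fun c d => b x c d) (Delta y)) (Delta h).
Proof.
(* [B] extends [b] linearly in its first slot from its values on the basis, and [tlift] makes it
   linear in [q]; so [comul_coassoc] can be pushed through [tlift B]. *)
pose B (a : H) (q : tensor H H) : X :=
  \sum_i v2r a 0 i *: tlift (b (r2v (delta_mx 0 i))) q.
have BE i q : B (r2v (delta_mx 0 i)) q = tlift (b (r2v (delta_mx 0 i))) q.
  rewrite /B (bigD1 i) //= big1 ?addr0 => [|j ne_ji]; rewrite r2vK mxE !eqxx.
    by rewrite scale1r.
  by rewrite (negPf ne_ji) scale0r.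
have Bl q : linear (B^~ q).
  move=> c x y; rewrite /B scaler_sumr -big_split; apply: eq_bigr => i _ /=.
  by rewrite linearP !mxE scalerDl scalerA.
have Br a : linear (B a).
  move=> c x y; rewrite /B scaler_sumr -big_split; apply: eq_bigr => i _ /=.
  by rewrite linearP scalerDr !scalerA mulrC.
have := f_equal (tlift B) (comul_coassoc hH h).
rewrite 2!(tlift_linear _ _ (tlift_is_linear _)) => E.
transitivity (tlift (fun x y =>
    tlift B (tlift (fun a c => tens a (tens c y)) (Delta x))) (Delta h)).
  apply: eq_tlift_basis => i j; rewrite (tlift_linear _ _ (tlift_is_linear _)).
  apply: eq_tlift_basis => p q; rewrite tlift_tens // BE.
  by rewrite tlift_tens_basis.
rewrite E; apply: eq_tlift_basis => i j.
by rewrite tlift_tens // BE.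
Qed.

Lemma counitlE (X : lmodType k) (f : H -> X) h : linear f ->
  tlift (fun x y => eps x *: f y) (Delta h) = f h.
Proof.
move=> fl; rewrite -[in RHS](counitl hH h) (tlift_linear _ _ fl).
by apply: eq_tlift => x y; rewrite linear_funZ.
Qed.

Lemma counitrE (X : lmodType k) (f : H -> X) h : linear f ->
  tlift (fun x y => eps y *: f x) (Delta h) = f h.
Proof.
move=> fl; rewrite -[in RHS](counitr hH h) (tlift_linear _ _ fl).
by apply: eq_tlift => x y; rewrite linear_funZ.
Qed.

Lemma antipodelE (X : lmodType k) (f : H -> X) h : linear f ->
  tlift (fun x y => f (S x * y)) (Delta h) = eps h *: f 1.
Proof.
by move=> fl; rewrite -linear_funZ // -(antipodel hH) (tlift_linear _ _ fl).
Qed.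

Lemma antipoderE (X : lmodType k) (f : H -> X) h : linear f ->
  tlift (fun x y => f (x * S y)) (Delta h) = eps h *: f 1.
Proof.
by move=> fl; rewrite -linear_funZ // -(antipoder hH) (tlift_linear _ _ fl).
Qed.

Lemma comulME (X : lmodType k) (b : H -> H -> X) g h :
  (forall y, linear (b^~ y)) -> (forall x, linear (b x)) ->
  tlift b (Delta (g * h)) =
  tlift (fun a c => tlift (fun a' c' => b (a * a') (c * c')) (Delta h)) (Delta g).
Proof.
move=> bl br; rewrite comulM (tlift_linear _ _ (tlift_is_linear b)).
apply: eq_tlift => a c; rewrite (tlift_linear _ _ (tlift_is_linear b)).
by apply: eq_tlift => a' c'; rewrite tlift_tens.
Qed.

Lemma comul1E (X : lmodType k) (b : H -> H -> X) :
  (forall y, linear (b^~ y)) -> (forall x, linear (b x)) ->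
  tlift b (Delta 1) = b 1 1.
Proof. by move=> bl br; rewrite comul1 tlift_tens. Qed.

Lemma antipode1 : S 1 = 1.
Proof.
have := antipodel hH 1; rewrite comul1E ?counit1 ?scale1r ?mulr1 //.
  by lin.
by lin.
Qed.

(** Both sides are convolution inverses of the multiplication: the sum S(x_1 y_1) x_2 y_2 S(y_3)
    S(x_3) collapses to either of them. *)
Lemma antipodeM x y : S (x * y) = S y * S x.
Proof.
have -> : S (x * y) = tlift (fun p b => tlift (fun x1 a =>
    tlift (fun q d => tlift (fun y1 c => S (x1 * y1) * (a * c) * (S d * S b))
      (Delta q)) (Delta y)) (Delta p)) (Delta x).
  rewrite (coassoc (fun x1 a b => _)).
  rewrite -(@counitrE _ (fun z => S (z * y))); last by lin.
  apply: eq_tlift => x1 r.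
  have := @antipoderE _ (fun z => S (x1 * y) * z) r.
  rewrite mulr1 => <-; last by lin.
  apply: eq_tlift => a b.
  rewrite -(@counitrE _ (fun z => S (x1 * z) * (a * S b)) y); last by lin.
  rewrite (coassoc (fun y1 c d => _)); apply: eq_tlift => y1 s.
  have := @antipoderE _ (fun z => S (x1 * y1) * (a * z * S b)) s.
  rewrite mulr1 => <-; last by lin.
  by apply: eq_tlift => c d; rewrite !mulrA.
transitivity (tlift (fun p b =>
    tlift (fun q d => (eps p * eps q) *: (S d * S b)) (Delta y)) (Delta x)).
  apply: eq_tlift => p b; rewrite (tlift_exchange (fun x1 a q d => _)).
  apply: eq_tlift => q d.
  rewrite -counitM.
  have := @antipodelE _ (fun z => z * (S d * S b)) (p * q).
  rewrite mul1r => <-; last by lin.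
  by rewrite comulME; lin.
rewrite -(@counitlE _ (fun z => S y * S z)); last by lin.
apply: eq_tlift => p b; rewrite -(@counitlE _ (fun z => S z * S b));
  last by lin.
rewrite tlift_scale.
by apply: eq_tlift => q d; rewrite scalerA.
Qed.

Lemma counit_antipode x : eps (S x) = eps x.
Proof.
rewrite -(@counitrE k^o (fun z => eps (S z))); last by lin.
have := @antipodelE k^o eps x; rewrite counit1 [_ *: _]mulr1 => <-; last by lin.
by apply: (@eq_tlift _ _ _ k^o) => a b; rewrite counitM mulrC.
Qed.

(** Same principle: h |-> Delta(S h) and h |-> S(h_2) (x) S(h_1) are a left and a right convolution
    inverse of Delta. [conv] is the right inverse property. *)
Lemma comul_antipodeE (X : lmodType k) (b : H -> H -> X) h :
  (forall y, linear (b^~ y)) -> (forall x, linear (b x)) ->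
  tlift b (Delta (S h)) = tlift (fun x y => b (S y) (S x)) (Delta h).
Proof.
move=> bl br.
have conv (b' : H -> H -> X) y :
    (forall y, linear (b'^~ y)) -> (forall x, linear (b' x)) ->
    tlift (fun c d => tlift (fun c1 c2 => tlift (fun d1 d2 =>
      b' (c1 * S d2) (c2 * S d1)) (Delta d)) (Delta c)) (Delta y)
    = eps y *: b' 1 1.
  move=> b'l b'r; rewrite (coassoc (fun c1 c2 d => _)).
  have := @antipoderE _ (fun z => b' z 1) y; move<-; last by lin.
  apply: eq_tlift => c1 r; rewrite -(coassoc (fun c2 d1 d2 => _)).
  rewrite -(@counitlE _ (fun z => b' (c1 * S z) 1)); last by lin.
  apply: eq_tlift => q d2.
  have := @antipoderE _ (fun z => b' (c1 * S d2) z) q; move=> <- //; by lin.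
transitivity (tlift (fun x y => tlift (fun c d => tlift (fun u v =>
   tlift (fun c1 c2 => tlift (fun d1 d2 => b (u * c1 * S d2) (v * c2 * S d1))
     (Delta d)) (Delta c)) (Delta (S x))) (Delta y)) (Delta h)).
  rewrite -(@counitrE _ (fun z => tlift b (Delta (S z)))); last by lin.
  apply: eq_tlift => x y.
  rewrite tlift_scale.
  rewrite (tlift_exchange (fun c d u v => _)); apply: eq_tlift => u v.
  have := conv (fun p q => b (u * p) (v * q)) y; rewrite !mulr1 => <-; try by lin.
  by apply: eq_tlift => c d; apply: eq_tlift => ? ?; apply: eq_tlift => ? ?; rewrite !mulrA.
rewrite -(coassoc (fun x c d => _)).
rewrite -(@counitlE _ (fun z => tlift (fun x y => b (S y) (S x)) (Delta z)));
  last by lin.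
apply: eq_tlift => p d.
transitivity (tlift (fun x c => tlift (fun r s => tlift (fun d1 d2 =>
    b (r * S d2) (s * S d1)) (Delta d)) (Delta (S x * c))) (Delta p)).
  apply: eq_tlift => x c; rewrite [in RHS]comulME //; by lin.
rewrite (@antipodelE _ (fun z => tlift (fun r s => _) (Delta z))); last by lin.
rewrite comul1E; try by lin.
by congr (_ *: _); apply: eq_tlift => ? ?; rewrite !mul1r.
Qed.

End Sweedler.

(** * The integral given by the trace of the square of the antipode *)

Section Trace.
Variables (k : fieldType).

Definition std_vec (V : vectType k) (i : 'I_(dim V)) : V := r2v (delta_mx 0 i).
Definition std_coord (V : vectType k) (i : 'I_(dim V)) (v : V) : k := v2r v 0 i.
Arguments std_vec : clear implicits.

Lemma std_coord_scalar (V : vectType k) i : scalar (@std_coord V i).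
Proof. by move=> a u v; rewrite /std_coord linearP !mxE. Qed.

HB.instance Definition _ (V : vectType k) i :=
  GRing.isSemilinear.Build k V k _ (@std_coord V i)
    (GRing.semilinear_linear (@std_coord_scalar V i)).

Lemma std_expand (V : vectType k) (v : V) :
  v = \sum_i std_coord i v *: std_vec V i.
Proof. exact: r2v_sum. Qed.

Lemma linear_fun_sum (V X : lmodType k) (f : V -> X) : linear f ->
  forall (I : finType) (c : I -> k) (v : I -> V),
  f (\sum_i c i *: v i) = \sum_i c i *: f (v i).
Proof.
move=> fl I c v; pose g : {linear V -> X} := HB.pack f
  (GRing.isSemilinear.Build k V X _ f (GRing.semilinear_linear fl)).
rewrite -[f]/(g : _ -> _) linear_sum; apply: eq_bigr => i _.
exact: linear_funZ.
Qed.

Lemma std_expand_fun (V : vectType k) (X : lmodType k) (f : V -> X) v :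
  linear f -> f v = \sum_i std_coord i v *: f (std_vec V i).
Proof. by move=> fl; rewrite [in LHS](std_expand v) linear_fun_sum. Qed.

Definition trace (V : vectType k) (f : V -> V) : k :=
  \sum_i std_coord i (f (std_vec V i)).

Lemma eq_trace (V : vectType k) (f g : V -> V) : f =1 g -> trace f = trace g.
Proof. by move=> e; apply: eq_bigr => i _; rewrite e. Qed.

Lemma trace_linear (V U : vectType k) (f : U -> V -> V) :
  (forall v, linear (f^~ v)) -> scalar (fun u => trace (f u)).
Proof.
move=> fl a u v; rewrite /trace mulr_sumr -big_split; apply: eq_bigr => i _ /=.
by rewrite fl linearP.
Qed.

Lemma trace_comp (V W : vectType k) (f : V -> W) (g : W -> V) :
  linear f -> linear g ->
  trace (fun x => f (g x)) = trace (fun x => g (f x)).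
Proof.
move=> fl gl; rewrite /trace.
under eq_bigr => i _ do rewrite (std_expand_fun _ fl) linear_sum /=.
under [RHS]eq_bigr => i _ do rewrite (std_expand_fun _ gl) linear_sum /=.
rewrite exchange_big; apply: eq_bigr => i _; apply: eq_bigr => j _ /=.
by rewrite !linearZ /= mulrC.
Qed.

Lemma trace_rank1 (V : vectType k) (phi : V -> k) (v : V) : scalar phi ->
  trace (fun x => phi x *: v) = phi v.
Proof.
move=> phil; rewrite (@std_expand_fun _ k^o phi) //.
by apply: eq_bigr => i _; rewrite linearZ; exact: mulrC.
Qed.

(** In the rank factorisation A = [col_base A] *m [row_base A], idempotence forces the reversed
    product to be 1, so the trace is the rank. *)
Lemma trace_idem (V : vectType k) (f : V -> V) : linear f ->
  (forall x, f (f x) = f x) ->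
  exists m, trace f = m%:R /\ (m = 0%N -> forall x, f x = 0).
Proof.
move=> fl ff; pose A := \matrix_(i, j) std_coord j (f (std_vec V i)).
have fE x : v2r (f x) = v2r x *m A.
  apply/rowP=> j; rewrite mxE (std_expand_fun _ fl) linear_sum summxE.
  by apply: eq_bigr => i _; rewrite linearZ /= !mxE.
have AA : A *m A = A.
  apply/row_matrixP=> i; rewrite row_mul.
  have -> : row i A = v2r (f (std_vec V i)) by apply/rowP=> j; rewrite !mxE.
  by rewrite -fE ff.
have AA' : row_base A *m col_base A = 1%:M.
  have /row_freeP [R BR] := row_base_free A.
  have /row_fullP [L LB] := col_base_full A.
  have LA : L *m A = row_base A by rewrite -[X in L *m X](mulmx_base A) mulmxA LB mul1mx.
  have AR : A *m R = col_base A by rewrite -[X in X *m R](mulmx_base A) -mulmxA BR mulmx1.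
  by rewrite -[in LHS]LA -AR mulmxA -(mulmxA L) AA LA.
exists (\rank A); split.
  transitivity (\tr A); first by apply: eq_bigr => i _; rewrite mxE.
  by rewrite -[in LHS](mulmx_base A) mxtrace_mulC AA' mxtrace1.
move=> /eqP; rewrite mxrank_eq0 => /eqP A0 x.
by apply: (can_inj v2rK); rewrite fE A0 mulmx0 linear0.
Qed.

End Trace.
Arguments std_vec {k} V i.

Section TraceIntegral.
Variables (k : fieldType) (H : falgType k) (hH : hopf H).

Notation S := (antipode hH).
Notation eps := (counit hH).
Notation Delta := (comul hH).

Definition trint (h : H) : k := trace (fun x => h * S (S x)).

Lemma trint_scalar : scalar trint.
Proof. by apply: trace_linear; lin. Qed.

HB.instance Definition _ := GRing.isSemilinear.Build k H k _ trint
  (GRing.semilinear_linear trint_scalar).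

(** Cyclicity of the trace and multiplicativity of S^2: the Nakayama automorphism of the form t(xy)
    is S^2. *)
Lemma trint_antipode2 x y : trint (x * y) = trint (y * S (S x)).
Proof.
transitivity (trace (fun z => x * (y * S (S z)))).
  by apply: eq_trace => z; rewrite mulrA.
rewrite (trace_comp (f := fun z => x * z) (g := fun z => y * S (S z))); try by lin.
by apply: eq_trace => z; rewrite !antipodeM mulrA.
Qed.

(** In the first leg S^2(x_2) S(x_1) = S(x_1 S(x_2)) collapses to a counit. The point is to move
    S^2(x) from one leg to under the comultiplication. *)
Lemma trint_split h x (X : lmodType k) (b : H -> H -> X) :
  (forall y, linear (b^~ y)) -> (forall x, linear (b x)) ->
  tlift (fun h1 h2 => b h1 (h2 * S (S x))) (Delta h) =
  tlift (fun x1 x2 => tlift (fun z1 z2 => b (z1 * S x1) z2)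
    (Delta (h * S (S x2)))) (Delta x).
Proof.
move=> bl br; symmetry.
transitivity (tlift (fun x1 x2 => tlift (fun a c => tlift (fun h1 h2 =>
   b (h1 * S (x1 * S a)) (h2 * S (S c))) (Delta h)) (Delta x2)) (Delta x)).
  apply: eq_tlift => x1 x2; rewrite comulME; try by lin.
  rewrite (tlift_exchange (fun h1 h2 a c => _)).
  rewrite comul_antipodeE; try by lin.
  rewrite comul_antipodeE; try by lin.
  by apply: eq_tlift => a c; apply: eq_tlift => h1 h2; rewrite antipodeM !mulrA.
rewrite -(coassoc hH (fun x1 a c => _)).
rewrite -(@counitlE _ _ hH _ (fun z => tlift (fun h1 h2 => b h1 (h2 * S (S z))) (Delta h)));
  last by lin.
apply: eq_tlift => p c.
have := @antipoderE _ _ hH _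
    (fun z => tlift (fun h1 h2 => b (h1 * S z) (h2 * S (S c))) (Delta h)) p.
rewrite antipode1 => ->; last by lin.
by congr (_ *: _); apply: eq_tlift => a d; rewrite mulr1.
Qed.

(** The trace is written on a basis e_i and [trint_split] moves S^2(e_i) under Delta. A second
    expansion, on e_j, lets the sum over i reassemble; the antipode axiom then cancels two legs of
    Delta(e_j), and the sum over j is again the trace. *)
Lemma trint_integral (X : lmodType k) (f : H -> X) h : linear f ->
  tlift (fun x y => trint y *: f x) (Delta h) = trint h *: f 1.
Proof.
move=> fl.
pose e := std_vec H; pose cd i : {scalar H} := @std_coord k H i.
transitivity (\sum_i tlift (fun x1 x2 => tlift (fun z1 z2 => cd i z2 *: f (z1 * S x1))
    (Delta (h * S (S x2)))) (Delta (e i))).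
  transitivity (tlift (fun x y => \sum_i cd i (y * S (S (e i))) *: f x) (Delta h)).
    by apply: eq_tlift => x y; rewrite -scaler_suml.
  rewrite tlift_sum; apply: eq_bigr => i _.
  by rewrite (trint_split _ _ (b := fun p q => cd i q *: f p)); lin.
transitivity (\sum_i \sum_j tlift (fun x1 x2 => tlift (fun z1 z2 =>
    (cd j (h * S (S x2)) * cd i z2) *: f (z1 * S x1)) (Delta (e j))) (Delta (e i))).
  apply: eq_bigr => i _; rewrite -tlift_sum; apply: eq_tlift => x1 x2.
  rewrite [in LHS](std_expand_fun
      (f := fun z => tlift (fun z1 z2 => cd i z2 *: f (z1 * S x1)) (Delta z)));
    last by lin.
  apply: eq_bigr => j _.
  rewrite tlift_scale.
  by apply: eq_tlift => z1 z2; rewrite scalerA.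
rewrite exchange_big /=.
transitivity (\sum_j tlift (fun z1 z2 => tlift (fun x1 x2 =>
    cd j (h * S (S x2)) *: f (z1 * S x1)) (Delta z2)) (Delta (e j))).
  apply: eq_bigr => j _.
  under eq_bigr => i _ do rewrite (tlift_exchange (fun x1 x2 z1 z2 => _)).
  rewrite -tlift_sum; apply: eq_tlift => z1 z2.
  rewrite [in RHS](std_expand_fun
      (f := fun z => tlift (fun x1 x2 => cd j (h * S (S x2)) *: f (z1 * S x1)) (Delta z)));
    last by lin.
  apply: eq_bigr => i _.
  rewrite tlift_scale.
  by apply: eq_tlift => x1 x2; rewrite scalerA mulrC.
rewrite scaler_suml; apply: eq_bigr => j _.
rewrite -(coassoc hH (fun z1 x1 x2 => _)).
rewrite -[RHS](@counitlE _ _ hH _ (fun z => cd j (h * S (S z)) *: f 1));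
  last by lin.
apply: eq_tlift => p c.
by rewrite (@antipoderE _ _ hH _ (fun z => cd j (h * S (S c)) *: f z)); lin.
Qed.

End TraceIntegral.

(** * Radford's formula for the fourth power of the antipode *)

(** The J-component of 1 works: for x in J, x times the other component lies in both J and its
    complement. *)
Lemma left_ideal_right_unit (k : fieldType) (A : falgType k) (J : {vspace A}) :
  semisimple A -> left_ideal J ->
  exists2 e, e \in J & forall x, x \in J -> x * e = x.
Proof.
move=> ssA JI; have [J' [J'I JJ' dJ]] := ssA J JI.
have /memv_addP [e eJ [e' e'J' e1]] : 1 \in (J + J')%VS by rewrite JJ' memvf.
exists e => // x xJ.
have mI (I : {vspace A}) a b : left_ideal I -> b \in I -> a * b \in I.
  by move=> /prodvP; apply; rewrite ?memvf.
suff : x * e' \in (J :&: J')%VS.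
  by rewrite dJ memv0 => /eqP xe'; rewrite -[RHS]mulr1 e1 mulrDr xe' addr0.
rewrite memv_cap [x * e' \in J']mI // andbT.
have -> : x * e' = x - x * e by rewrite -[x in x - _]mulr1 e1 mulrDr addrAC subrr add0r.
by rewrite memvB // mI.
Qed.

Lemma semisimple_integral (k : fieldType) (H : falgType k) (hH : hopf H) :
  semisimple H ->
  exists Lambda : H, [/\ counit hH Lambda = 1,
    forall h, h * Lambda = counit hH h *: Lambda &
    forall h, Lambda * h = counit hH h *: Lambda].
Proof.
move=> ssH; pose J := lker (linfun (counit hH : H -> k^o)).
have JE x : (x \in J) = (counit hH x == 0) by rewrite memv_ker lfunE.
have JI : left_ideal J.
  by apply/prodvP => a b _; rewrite !JE counitM => /eqP ->; rewrite mulr0.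
have [e eJ eP] := left_ideal_right_unit ssH JI.
(* [e] is a right unit of the augmentation ideal J, so J kills 1 - e from the left; this makes [Lam]
   a left integral. *)
pose Lam := 1 - e; have epsL : counit hH Lam = 1.
  by move: eJ; rewrite JE linearB /= counit1 => /eqP ->; rewrite subr0.
have sub_eps h : h - (counit hH h)%:A \in J.
  by rewrite JE linearB linearZ /= counit1 mulr1 subrr.
have LamL h : h * Lam = counit hH h *: Lam.
  apply/eqP; rewrite -subr_eq0 -[counit hH h *: _]mulr_algl -mulrBl /Lam.
  by rewrite mulrBr mulr1 eP ?subrr.
exists Lam; split=> // h; pose y := Lam * (h - (counit hH h)%:A).
have yL g : g * y = counit hH g *: y by rewrite mulrA LamL scalerAl.
(* [y] spans a left ideal of square zero; its right unit shows y = 0, which is right invariance of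
   [Lam]. *)
have yI : left_ideal <[y]>.
  by apply/prodvP => a b _ /vlineP [c ->]; rewrite -scalerAr yL scalerA memvZ ?memv_line.
have [_ /vlineP [c ->] /(_ y (memv_line y))] := left_ideal_right_unit ssH yI.
have -> : y * (c *: y) = 0.
  have := sub_eps h; rewrite JE -scalerAr yL /y counitM => /eqP ->.
  by rewrite mulr0 scale0r scaler0.
rewrite /y => /esym/eqP.
by rewrite mulrBr subr_eq0 mulr_algr => /eqP.
Qed.

Section Integral.
Variables (k : fieldType) (H : falgType k) (hH : hopf H) (Lam : H).

Notation S := (antipode hH).
Notation eps := (counit hH).
Notation Delta := (comul hH).
Notation t := (trint hH).

Hypotheses (epsL : eps Lam = 1)
  (LamR : forall h, Lam * h = eps h *: Lam).

Lemma trint_Lam : t Lam = 1.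
Proof.
rewrite -epsL -[eps Lam]counit_antipode -[eps (S Lam)]counit_antipode.
rewrite -(trace_rank1 (phi := fun x => eps (S (S x)))); last by lin.
by apply: eq_trace => x; rewrite LamR.
Qed.

(** Write h = h_1 eps(h_2) and absorb eps(h_2) into Lam h_2; then S(Lam_1 h_2) = S(h_2) S(Lam_1) and
    h_1 S(h_2) cancels. *)
Lemma Lam_balanced (X : lmodType k) (b : H -> H -> X) h :
  (forall y, linear (b^~ y)) -> (forall x, linear (b x)) ->
  tlift (fun x y => b (h * S x) y) (Delta Lam) =
  tlift (fun x y => b (S x) (y * h)) (Delta Lam).
Proof.
move=> bl br.
transitivity (tlift (fun h1 r => tlift (fun x y => b (h1 * S x) y)
   (Delta (Lam * r))) (Delta h)).
  rewrite -[LHS](@counitrE _ _ hH _ (fun z => tlift (fun x y => b (z * S x) y) (Delta Lam)));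
    last by lin.
  by apply: eq_tlift => h1 r; rewrite LamR linearZ linearZ.
transitivity (tlift (fun h1 r => tlift (fun h2 h3 => tlift (fun x y =>
   b (h1 * S h2 * S x) (y * h3)) (Delta Lam)) (Delta r)) (Delta h)).
  apply: eq_tlift => h1 r; rewrite comulME; try by lin.
  rewrite (tlift_exchange (fun x y h2 h3 => _)); apply: eq_tlift => h2 h3.
  by apply: eq_tlift => x y; rewrite antipodeM mulrA.
rewrite -(coassoc hH (fun h1 h2 h3 => _)).
rewrite -[RHS](@counitlE _ _ hH _ (fun z => tlift (fun x y => b (S x) (y * z)) (Delta Lam)));
  last by lin.
apply: eq_tlift => p h3.
rewrite (@antipoderE _ _ hH _
    (fun z => tlift (fun x y => b (z * S x) (y * h3)) (Delta Lam)));
  last by lin.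
by congr (_ *: _); apply: eq_tlift => x y; rewrite mul1r.
Qed.

(** S(Lam_1) and Lam_2 are dual bases for the form t, which is therefore a Frobenius form. *)
Lemma trint_dual_basis h :
  tlift (fun x y => t (y * h) *: S x) (Delta Lam) = h.
Proof.
rewrite -(Lam_balanced (b := fun x y => t y *: x)); try by lin.
rewrite (trint_integral hH (f := fun x => h * S x)); last by lin.
by rewrite trint_Lam scale1r antipode1 mulr1.
Qed.

Lemma antipode_surj h : exists g, h = S g.
Proof.
exists (tlift (fun x y => t (y * h) *: x) (Delta Lam)).
rewrite (tlift_linear (f := S)); last by lin.
by rewrite -[LHS]trint_dual_basis; apply: eq_tlift => x y; rewrite linearZ.
Qed.

Lemma antipode_inj : injective S.
Proof.
have Sl : limg (linfun S) = fullv.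
  apply/eqP; rewrite eqEsubv subvf; apply/subvP => h _.
  by have [g ->] := antipode_surj h; rewrite -[S g]lfunE memv_img ?memvf.
have /eqP := limg_ker_dim (linfun S) fullv.
rewrite Sl capfv -[X in _ == X]add0n eqn_add2r dimv_eq0 => /eqP kS.
move=> x y e; have : x - y \in lker (linfun S) by rewrite memv_ker lfunE linearB /= e subrr.
by rewrite kS memv0 subr_eq0 => /eqP.
Qed.

Lemma trint_nondegr h : (forall x, t (x * h) = 0) -> h = 0.
Proof.
by move=> th; rewrite -(trint_dual_basis h) tlift_eq0 // => x y; rewrite th scale0r.
Qed.

Lemma trint_nondegl h : (forall x, t (h * x) = 0) -> h = 0.
Proof.
move=> th; apply: antipode_inj; apply: antipode_inj; rewrite !linear0.
by apply: trint_nondegr => x; rewrite -trint_antipode2.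
Qed.

Lemma trint_dual_basis1 : tlift (fun x y => t (S x) *: y) (Delta Lam) = 1.
Proof.
apply/eqP; rewrite -subr_eq0; apply/eqP/trint_nondegl => h.
rewrite mulrBl mul1r linearB /=; apply/eqP; rewrite subr_eq0; apply/eqP.
rewrite -[in RHS](trint_dual_basis h) (@tlift_linear _ _ _ _ k^o t);
  last by lin.
rewrite (@tlift_linear _ _ _ _ k^o (fun z => t (z * h))); last by lin.
apply: (@eq_tlift _ _ _ k^o) => x y.
by rewrite -scalerAl !linearZ /=; exact: mulrC.
Qed.

(* The second hypothesis says x_1 (x) mu(x_2) = 1 (x) mu(x).                   *)
Lemma integral_unique (X : lmodType k) (mu : H -> X) h :
  linear mu ->
  (forall (Y : lmodType k) (b : H -> X -> Y) g,
     (forall y, linear (b^~ y)) -> (forall x, linear (b x)) ->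
     tlift (fun x y => b x (mu y)) (Delta g) = b 1 (mu g)) ->
  mu h = t h *: mu Lam.
Proof.
move=> mul muI.
(* Balancing equates t(h S(Lam_1)) mu(Lam_2) with t(S(Lam_1)) mu(Lam_2 h). The first collapses to
   t(h) mu(Lam) by invariance of [mu], the second to mu(h) by [trint_dual_basis1]. *)
have := @Lam_balanced X (fun x y => t x *: mu y) h.
rewrite (muI X (fun x v => t (h * S x) *: v)); try by lin.
rewrite antipode1 mulr1 => ->; try by lin.
have := f_equal (fun z => mu (z * h)) trint_dual_basis1; rewrite mul1r => <-.
rewrite (tlift_linear (f := fun z => mu (z * h))); last by lin.
by apply: eq_tlift => x y; rewrite -scalerAl linear_funZ.
Qed.

(** The distinguished grouplike element: by [trint_gamma] it measures how far t is from being an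
    integral on the other side. *)
Definition dist_grouplike : H := tlift (fun x y => t x *: y) (Delta Lam).
Notation gamma := dist_grouplike.

Lemma trint_gamma (X : lmodType k) (f : H -> X) h : linear f ->
  tlift (fun x y => t x *: f y) (Delta h) = t h *: f gamma.
Proof.
move=> fl; rewrite (@integral_unique X (fun z => tlift (fun x y => t x *: f y) (Delta z))).
- rewrite /gamma (tlift_linear (f := f)) //; congr (_ *: _).
  by apply: eq_tlift => x y; rewrite linear_funZ.
- by lin.
move=> Y b g bl br.
transitivity (tlift (fun h1 r => tlift (fun h2 h3 => t h2 *: b h1 (f h3)) (Delta r)) (Delta g)).
  apply: eq_tlift => x y; rewrite (tlift_linear (f := b x)) //.
  by apply: eq_tlift => x' y'; rewrite linear_funZ.
rewrite -(coassoc hH (fun h1 h2 h3 => _)) (tlift_linear (f := b 1)) //.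
apply: eq_tlift => p h3.
by rewrite (trint_integral hH (f := fun h1 => b h1 (f h3))) ?linear_funZ //; lin.
Qed.

Lemma gamma_grouplike (X : lmodType k) (b : H -> H -> X) :
  (forall y, linear (b^~ y)) -> (forall x, linear (b x)) ->
  tlift b (Delta gamma) = b gamma gamma.
Proof.
move=> bl br.
transitivity (tlift (fun x y => tlift (fun c d => t x *: b c d) (Delta y)) (Delta Lam)).
  rewrite [in LHS]/gamma (tlift_linear (f := fun z => tlift b (Delta z)));
    last by lin.
  by apply: eq_tlift => x y; rewrite -tlift_scale !linearZ_LR.
rewrite -(coassoc hH (fun x c d => _)).
transitivity (tlift (fun p d => t p *: b gamma d) (Delta Lam)).
  by apply: eq_tlift => p d; rewrite (trint_gamma (f := fun c => b c d)).
by rewrite trint_gamma // trint_Lam scale1r.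
Qed.

Lemma counit_gamma : eps gamma = 1.
Proof.
rewrite -trint_Lam -(@counitrE _ _ hH k^o t) /gamma; last by lin.
rewrite (@tlift_linear _ _ _ _ k^o eps); last by lin.
by apply: (@eq_tlift _ _ _ k^o) => x y; rewrite linearZ; exact: mulrC.
Qed.

Lemma antipode_gammal : S gamma * gamma = 1.
Proof.
have := antipodel hH gamma; rewrite gamma_grouplike ?counit_gamma ?scale1r //; by lin.
Qed.

Lemma antipode_gammar : gamma * S gamma = 1.
Proof.
have := antipoder hH gamma; rewrite gamma_grouplike ?counit_gamma ?scale1r //; by lin.
Qed.

Lemma antipode2_gamma : S (S gamma) = gamma.
Proof.
rewrite -[LHS]mul1r -antipode_gammar -mulrA -antipodeM antipode_gammal.
by rewrite antipode1 mulr1.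
Qed.

Lemma trint_right_integral (X : lmodType k) (f : H -> X) h : linear f ->
  tlift (fun x y => t (x * gamma) *: f y) (Delta h) = t (h * gamma) *: f 1.
Proof.
move=> fl; have := @trint_gamma X (fun z => f (z * S gamma)) (h * gamma).
rewrite antipode_gammar => <-; last by lin.
rewrite comulME; try by lin.
apply: eq_tlift => x y; rewrite gamma_grouplike; try by lin.
by rewrite -mulrA antipode_gammar mulr1.
Qed.

(** t(Lam y_1 gamma) S(y_2) is computed twice: Lam absorbs y_1 and gamma, giving S(y); expanded by
    the invariance of t( . gamma), a factor y_2 S(y_3) cancels instead. *)
Lemma antipode_trint y :
  S y = tlift (fun x z => t (x * y * gamma) *: z) (Delta Lam).
Proof.
transitivity (tlift (fun q y3 => t (Lam * q * gamma) *: S y3) (Delta y)).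
  rewrite -[LHS](@counitlE _ _ hH _ S); last by lin.
  apply: eq_tlift => a c; rewrite LamR -scalerAl LamR counit_gamma scale1r.
  by rewrite linearZ /= trint_Lam mulr1.
transitivity (tlift (fun q y3 => tlift (fun q1 q2 => tlift (fun x z =>
   t (x * q1 * gamma) *: (z * (q2 * S y3))) (Delta Lam)) (Delta q)) (Delta y)).
  apply: eq_tlift => q y3.
  have := @trint_right_integral _ (fun z => z * S y3) (Lam * q).
  rewrite mul1r => <-; last by lin.
  rewrite comulME; try by lin.
  rewrite (tlift_exchange (fun x z q1 q2 => _)); apply: eq_tlift => q1 q2.
  by apply: eq_tlift => x z; rewrite mulrA.
rewrite (coassoc hH (fun q1 q2 y3 => _)).
rewrite -[RHS](@counitrE _ _ hH _ (fun v => tlift (fun x z => t (x * v * gamma) *: z) (Delta Lam)));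
  last by lin.
apply: eq_tlift => q1 r.
rewrite (@antipoderE _ _ hH _
    (fun v => tlift (fun x z => t (x * q1 * gamma) *: (z * v)) (Delta Lam)));
  last by lin.
by congr (_ *: _); apply: eq_tlift => x z; rewrite mulr1.
Qed.

(** By [antipode_trint] the left side is t(Lam_1 y gamma) t(Lam_2 gamma), and [dE] contracts it to
    t(gamma^-1 y gamma); gamma is fixed by S^2, so the Nakayama rule removes the conjugation. *)
Lemma trint_antipode_gamma y : t (S y * gamma) = t y.
Proof.
have dE : tlift (fun x z => t (z * gamma) *: x) (Delta Lam) = S gamma.
  have := @trint_integral _ _ hH _ (fun x => x * S gamma) (Lam * gamma).
  rewrite LamR counit_gamma scale1r trint_Lam scale1r mul1r => <-; last by lin.
  have {2}-> : Lam = Lam * gamma by rewrite LamR counit_gamma scale1r.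
  rewrite comulME; try by lin.
  apply: eq_tlift => x z; rewrite gamma_grouplike; try by lin.
  by rewrite -mulrA antipode_gammar mulr1.
transitivity (t (S gamma * y * gamma)); last first.
  by rewrite -mulrA trint_antipode2 antipode2_gamma -mulrA antipode_gammar mulr1.
rewrite antipode_trint -dE.
rewrite (@tlift_linear _ _ _ _ k^o (fun v => t (v * gamma))); last by lin.
rewrite (@tlift_linear _ _ _ _ k^o (fun v => t (v * y * gamma))); last by lin.
apply: (@eq_tlift _ _ _ k^o) => x z.
by rewrite -!scalerAl !linearZ /=; exact: mulrC.
Qed.

(** For a = S y and b = S x, two uses each of [trint_antipode_gamma] and [trint_antipode2] turn t(a
    b gamma) into t(a gamma S^4(b)), and t is nondegenerate. *)
Lemma antipode4 b : b * gamma = gamma * S (S (S (S b))).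
Proof.
have [x ->] := antipode_surj b.
apply/eqP; rewrite -subr_eq0; apply/eqP/trint_nondegr => a.
have [y ->] := antipode_surj a.
rewrite mulrBr linearB /=; apply/eqP; rewrite subr_eq0; apply/eqP.
rewrite !mulrA -antipodeM trint_antipode_gamma trint_antipode2.
rewrite -trint_antipode_gamma antipodeM -mulrA trint_antipode2.
by rewrite -!mulrA.
Qed.

End Integral.

(** * Integer polynomials at primitive roots of unity *)

Lemma intr_char0_eq0 (K : fieldType) (m : int) : [pchar K] =i pred0 ->
  (m%:~R == 0 :> K) = (m == 0).
Proof.
by move/pcharf0P => K0; case: m => n; rewrite ?NegzE ?rmorphN ?oppr_eq0 /= K0.
Qed.

Section CyclotomicTransfer.
Variable n : nat.
Hypothesis n_gt0 : (0 < n)%N.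

Local Notation Phi := (map_poly (intr : int -> rat) 'Phi_n).

(** The polynomial is the minimal polynomial of a complex primitive root, so it divides whichever
    factor vanishes there. *)
Lemma Cyclotomic_irreducible : irreducible_poly Phi.
Proof.
have [z zP] := C_prim_root_exists n_gt0.
have [p [pE _] pP] := minCpolyP z.
have zE (q : {poly rat}) : root (map_poly ratr q) z = (Phi %| q).
  rewrite pP; congr (_ %| _); apply: (map_poly_inj (ratr : {rmorphism rat -> algC})).
  rewrite -pE (minCpoly_cyclotomic zP) -(Cintr_Cyclotomic zP) -map_poly_comp.
  by apply: eq_map_poly => i /=; rewrite ratr_int.
have Phi0 : Phi != 0 by apply/monic_neq0/monic_map/Cyclotomic_monic.
split=> [|q q1 /dvdpP [r PhiE]].
  rewrite size_map_poly_id0 ?size_Cyclotomic ?(eqP (Cyclotomic_monic n)) ?oner_eq0 //.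
  by rewrite ltnS totient_gt0.
have : root (map_poly ratr Phi : {poly algC}) z by rewrite zE.
rewrite PhiE rmorphM rootM !zE => /orP [] Pd; last first.
  by rewrite /eqp dvdp_mull // -PhiE Pd.
have r0 : r != 0 by apply: contraNneq Phi0 => r0; rewrite PhiE r0 mul0r.
have q0 : q != 0 by apply: contraNneq Phi0 => q0; rewrite PhiE q0 mulr0.
have := dvdp_leq r0 Pd; rewrite PhiE size_mul // -subn1 leq_subLR [X in (_ <= X)%N]addnC leq_add2l.
by move: q1; rewrite -size_poly_gt0 in q0; case: (size q) q0 => [|[|m]].
Qed.

Section Field.
Variables (K : fieldType) (z : K).
Hypotheses (char0 : [pchar K] =i pred0) (zP : n.-primitive_root z).

Local Notation ev q := ((map_poly (intr : int -> K) q).[z]).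

Lemma Cyclotomic_prim_root : ev 'Phi_n = 0.
Proof.
have : \prod_(d <- divisors n) ev 'Phi_d = 0.
  rewrite -horner_prod -(rmorph_prod (map_poly (intr : int -> K))) prod_Cyclotomic //.
  rewrite rmorphB rmorph1 /= map_polyXn !hornerE.
  by rewrite prim_expr_order // subrr.
move/eqP; rewrite prodf_seq_eq0 => /hasP [d]; rewrite -dvdn_divisors //= => dn /eqP ev0.
have d0 : (0 < d)%N by apply: dvdn_gt0 dn.
suff : z ^+ d = 1.
  move/eqP; rewrite -(prim_order_dvd zP) => nd.
  by have /eqP <- : d == n by rewrite eqn_dvd dn nd.
have /eqP := f_equal (fun q => ev q) (prod_Cyclotomic d0).
rewrite (bigD1_seq d) ?divisors_uniq -?dvdn_divisors //= rmorphM hornerM ev0 mul0r.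
rewrite rmorphB rmorph1 /= map_polyXn !hornerE eq_sym subr_eq0 => /eqP //.
Qed.

(** The right side mentions neither the field nor the root: vanishing of an integer polynomial at a
    primitive n-th root of unity transfers between fields of characteristic zero. If Phi does not
    divide q, a Bezout relation with denominators cleared gives a nonzero integer equal to 0. *)
Lemma prim_root_evalP (q : {poly int}) :
  ev q = 0 <-> Phi %| map_poly (intr : int -> rat) q.
Proof.
split; last first.
  rewrite dvdp_rat_int => /dvdpP_int [r ->].
  have -> : zprimitive 'Phi_n = 'Phi_n.
    by rewrite [RHS]zpolyEprim zcontents_monic ?Cyclotomic_monic ?scale1r.
  by rewrite rmorphM hornerM Cyclotomic_prim_root mul0r.
move=> q0; apply: contraT; rewrite -(irreducible_poly_coprime _ Cyclotomic_irreducible).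
case/Bezout_eq1_coprimepP => -[u v] /=.
have [u' [a a0 ->]] := rat_poly_scale u; have [v' [b b0 ->]] := rat_poly_scale v.
move=> uv1; have aQ0 : a%:~R != 0 :> rat by rewrite intr_eq0.
have bQ0 : b%:~R != 0 :> rat by rewrite intr_eq0.
have : b *: (u' * 'Phi_n) + a *: (v' * q) = (a * b)%:P.
  apply: (map_inj_poly _ _ : injective (map_poly (intr : int -> rat))) => //.
    exact: intr_inj.
  rewrite map_polyC /= rmorphM /= -[RHS]mulr1 mul_polyC -uv1.
  rewrite rmorphD /= !map_polyZ !rmorphM /= scalerDr -!scalerAl !scalerA.
  by rewrite mulfK // mulrAC divff // mul1r.
move/(f_equal (fun p => ev p)).
rewrite map_polyC hornerC rmorphD /= !map_polyZ !rmorphM /= !hornerE q0 /=.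
rewrite Cyclotomic_prim_root !mulr0 addr0 => /esym/eqP.
by rewrite -intrM intr_char0_eq0 // mulf_eq0 (negPf a0) (negPf b0).
Qed.

End Field.
End CyclotomicTransfer.

(** * The regular trace of a semisimple algebra *)

Lemma nondegenerate_repr (k : fieldType) (V : vectType k) (B : V -> V -> k)
    (f : V -> k) :
  (forall y, scalar (B^~ y)) -> (forall x, scalar (B x)) ->
  (forall y, (forall x, B x y = 0) -> y = 0) -> scalar f ->
  exists w, forall x, f x = B x w.
Proof.
move=> Bl Br Bnd fl; pose M := \matrix_(i, j) B (std_vec V j) (std_vec V i).
have ME v j : (v *m M) 0 j = B (std_vec V j) (r2v v).
  rewrite (@std_expand_fun _ _ k^o (B _)) // mxE; apply: eq_bigr => i _.
  by rewrite mxE /std_coord r2vK.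
have Mfree : row_free M.
  apply: inj_row_free => v /rowP v0.
  apply: (can_inj r2vK); rewrite linear0; apply: Bnd => x.
  rewrite (@std_expand_fun _ _ k^o (B^~ _)) // big1 // => j _.
  by rewrite -ME v0 mxE scaler0.
exists (r2v ((\row_j f (std_vec V j)) *m invmx M)) => x.
rewrite [LHS](@std_expand_fun _ _ k^o) // [RHS](@std_expand_fun _ _ k^o (B^~ _)) //.
by apply: eq_bigr => j _; rewrite -ME mulmxKV -?row_free_unit // mxE.
Qed.

Section RegularTrace.
Variables (k : fieldType) (A : falgType k).

Definition regtr (a : A) : k := trace (fun x => a * x).

Lemma regtr_scalar : scalar regtr.
Proof. by apply: trace_linear; lin. Qed.

HB.instance Definition _ := GRing.isSemilinear.Build k A k _ regtr
  (GRing.semilinear_linear regtr_scalar).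

Lemma regtrC a b : regtr (a * b) = regtr (b * a).
Proof.
rewrite /regtr; under eq_trace => x do rewrite -mulrA.
rewrite (trace_comp (f := fun x => a * x) (g := fun x => b * x)); try by lin.
by under [RHS]eq_trace => x do rewrite -mulrA.
Qed.

Lemma regtr_idem e : e * e = e ->
  exists m, regtr e = m%:R /\ (m = 0%N -> e = 0).
Proof.
move=> ee; have [||m [mE m0]] := @trace_idem _ A (fun x => e * x); first by lin.
  by move=> x; rewrite mulrA ee.
by exists m; split=> // /m0 /(_ 1); rewrite mulr1.
Qed.

Definition central (z : A) := forall x, x * z = z * x.

Definition central_idem (e : A) := central e /\ e * e = e.

Definition primitive_central_idem (e : A) :=
  [/\ central_idem e, e != 0 &
      forall f, central_idem f -> f * e = f -> f = 0 \/ f = e].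

Section Semisimple.
Hypotheses (ssA : semisimple A).

Lemma principal_left_ideal_idem (w : A) :
  exists y : A, (y * w) * (y * w) = y * w /\ forall x, (x * w) * (y * w) = x * w.
Proof.
have JI : left_ideal (amulr w @: {: A})%VS.
  apply/prodvP => a _ _ /memv_imgP [b _ ->].
  by rewrite lfunE /= mulrA; apply/memv_imgP; exists (a * b); rewrite ?memvf // lfunE.
have [_ /memv_imgP [y _ ->]] := left_ideal_right_unit ssA JI.
rewrite lfunE /= => yP; exists y.
have yw x : (x * w) * (y * w) = x * w.
  by apply: yP; apply/memv_imgP; exists x; rewrite ?memvf // lfunE.
by split.
Qed.

(** The left ideal A x is generated by an idempotent y x, whose regular trace is its rank; in
    characteristic zero trace 0 means y x = 0. *)
Lemma regtr_nondegenerate x : [pchar k] =i pred0 ->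
  (forall y, regtr (y * x) = 0) -> x = 0.
Proof.
move=> /pcharf0P char0 x0; have [y [yy yP]] := principal_left_ideal_idem x.
have [m [mE m0]] := regtr_idem yy.
have /eqP := x0 y; rewrite mE char0 => /eqP /m0 yx0.
by have := yP 1; rewrite yx0 mul1r mulr0.
Qed.

(** The idempotent f = y w is central because f x and x f both equal f x f: A w is a left ideal with
    right unit f, and w (1 - f) = 0 with w central. *)
Lemma central_ideal_idem w : central w ->
  exists y : A, central_idem (y * w) /\ w * (y * w) = w.
Proof.
move=> wC; have [y [yy yP]] := principal_left_ideal_idem w.
have wf : w * (y * w) = w by have := yP 1; rewrite mul1r.
exists y; split=> //; split=> // x; set f := y * w in yy yP wf *.
have -> : f * x = f * x * f.
  have -> : f * x = y * x * w by rewrite /f -mulrA -wC mulrA.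
  by rewrite yP.
have : (1 - f) * x * f = 0.
  rewrite {2}/f [_ * (y * w)]mulrA wC !mulrA mulrBr mulr1 wf subrr.
  by rewrite !mul0r.
by rewrite mulrBl mul1r mulrBl => /eqP; rewrite subr_eq0 => /eqP.
Qed.

End Semisimple.
End RegularTrace.

(** Schur's argument: z has an eigenvector x in the block eA, with eigenvalue c. The central
    idempotent generating the ideal of (z - c) e is 0 or e, and it is not e since it kills x. *)
Lemma primitive_central_scalar (k : closedFieldType) (A : falgType k) (e z : A) :
  semisimple A -> primitive_central_idem e -> central z ->
  exists c : k, z * e = c *: e.
Proof.
move=> ssA [[eC ee] e0 eP] zC.
pose U := (amull e @: {: A})%VS.
have UE x : (x \in U) = (e * x == x).
  apply/memv_imgP/eqP => [[y _ ->]|<-]; first by rewrite lfunE /= mulrA ee.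
  by exists x; rewrite ?memvf // lfunE.
pose g (x : subvs_of U) : subvs_of U := vsproj U (z * vsval x).
have gE x : vsval (g x) = z * vsval x.
  rewrite /g vsprojK // UE mulrA -eC -mulrA.
  by have := subvsP x; rewrite UE => /eqP ->.
have gl : linear g by rewrite /g; lin.
pose G := \matrix_(i, j) std_coord j (g (std_vec (subvs_of U) i)).
have GE v : r2v (v *m G) = g (r2v v).
  apply: (can_inj v2rK); rewrite r2vK; apply/rowP => j.
  rewrite mxE (std_expand_fun _ gl) linear_sum summxE; apply: eq_bigr => i _.
  by rewrite linearZ /= !mxE /std_coord r2vK.
have U0 : (0 < dim (subvs_of U))%N.
  rewrite -dimvf lt0n dimv_eq0; apply: contraNneq e0 => U0.
  have := memvf (vsproj U e); rewrite U0 memv0 -(inj_eq val_inj) /=.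
  by rewrite vsprojK // UE ee.
have /closed_rootP [c rGc] : size (char_poly G) != 1%N.
  by rewrite size_char_poly; case: (dim _) U0.
move: rGc; rewrite -eigenvalue_root_char => /eigenvalueP [v vG v0].
exists c; pose w := (z - c%:A) * e.
pose x := vsval (r2v v : subvs_of U).
have x0 : x != 0.
  apply: contraNneq v0 => x0; have rv0 : (r2v v : subvs_of U) = 0 by exact: val_inj.
  by rewrite -(r2vK (v : 'rV_(dim (subvs_of U)))) rv0 linear0.
have ex : e * x = x by apply/eqP; rewrite -UE subvsP.
have wx : w * x = 0.
  rewrite /w -mulrA ex mulrBl /x -gE -GE vG linearZ /=.
  by rewrite mulr_algl subrr.
have wC : central w.
  move=> y; rewrite /w -mulrA -eC !mulrA; congr (_ * e).
  by rewrite mulrBl mulrBr zC mulr_algl mulr_algr.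
have [y [fC wf]] := central_ideal_idem ssA wC.
have fe : y * w * e = y * w by rewrite /w -!mulrA ee.
case: (eP _ fC fe) => [f0|f1].
  move: wf; rewrite f0 mulr0 => /esym/eqP.
  by rewrite /w mulrBl subr_eq0 mulr_algl => /eqP.
by case/eqP: x0; rewrite -ex -f1 -mulrA wx mulr0.
Qed.

Lemma central_idem_decomp (k : fieldType) (A : falgType k) (e : A) :
  central_idem e ->
  exists s : seq A,
    [/\ forall a, a \in s -> primitive_central_idem a /\ a * e = a,
        uniq s /\ {in s &, forall a b, a != b -> a * b = 0} & e = \sum_(a <- s) a].
Proof.
have [n] := ubnP (\dim (limg (amull e))); elim: n e => // n IHn e.
rewrite ltnS => le_en [eC ee].
have [->|e0] := eqVneq e 0; first by exists [::]; rewrite big_nil.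
have [[f [[fC ff] fe f0 fne]]|prim] :=
    pselect (exists f, [/\ central_idem f, f * e = f, f != 0 & f != e]); last first.
  exists [:: e]; split; rewrite ?big_seq1 //=; last first.
    by split=> // a b; rewrite !inE => /eqP -> /eqP ->; rewrite eqxx.
  move=> a; rewrite inE => /eqP ->; split=> //; split=> // f fC fe.
  have [->|f0] := eqVneq f 0; first by left.
  have [->|fne] := eqVneq f e; first by right.
  by case: prim; exists f.
have lt_dim (g : A) : central_idem g -> g * e = g -> g != e ->
    (\dim (limg (amull g)) < n)%N.
  move=> [gC gg] ge gne; apply: leq_trans le_en.
  rewrite ltn_neqAle; have sub : (limg (amull g) <= limg (amull e))%VS.
    apply/subvP => _ /memv_imgP [x _ ->]; apply/memv_imgP; exists (g * x).
      by rewrite memvf.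
    by rewrite !lfunE /= mulrA gC ge.
  rewrite dimvS // andbT; apply: contraNneq gne => dim_eq.
  have /eqP E : (limg (amull g) == limg (amull e))%VS by rewrite eqEdim sub dim_eq /=.
  have : e \in limg (amull e) by apply/memv_imgP; exists e; rewrite ?memvf ?lfunE /= ?ee.
  rewrite -E => /memv_imgP [x _ eE]; rewrite -ge {1}eE lfunE /= mulrA gg.
  by rewrite eE lfunE.
pose g := e - f; have ef : e * f = f by rewrite fC.
have gC : central_idem g.
  split=> [x|]; first by rewrite mulrBr mulrBl eC fC.
  by rewrite /g mulrBr !mulrBl ee ef fe ff subrr subr0.
have ge : g * e = g by rewrite /g mulrBl ee fe.
have gne : g != e by rewrite -subr_eq0 /g addrAC subrr add0r oppr_eq0.
have [s [sP s_orth sE]] := IHn f (lt_dim f (conj fC ff) fe fne) (conj fC ff).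
have [r [rP r_orth rE]] := IHn g (lt_dim g gC ge gne) gC.
exists (s ++ r); split.
- move=> a; rewrite mem_cat => /orP [/sP|/rP] [ap aE]; split=> //.
    by rewrite -aE -mulrA fe.
  by rewrite -aE -mulrA ge.
- have [s_uniq s0] := s_orth; have [r_uniq r0] := r_orth.
  have sr0 a b : a \in s -> b \in r -> a * b = 0.
    move=> /sP [_ aE] /rP [_ bE].
    by rewrite -aE -bE (gC.1 b) mulrA -[a * f * g]mulrA /g mulrBr fe ff subrr mulr0 mul0r.
  split; last first.
    move=> a b; rewrite !mem_cat => /orP [] aP /orP [] bP ab; [exact: s0| | |exact: r0].
      exact: sr0.
    by have [[[bC _] _ _] _] := sP b bP; rewrite bC sr0.
  rewrite cat_uniq s_uniq r_uniq andbT /=; apply/hasPn => a a_r /=.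
  apply/negP => a_s; have [[[_ aa] /eqP a0 _] _] := sP a a_s.
  by apply: a0; rewrite -aa sr0.
by rewrite big_cat /= -sE -rE /g addrCA subrr addr0.
Qed.

Lemma closed_prim_root_exists (k : closedFieldType) n : [pchar k] =i pred0 ->
  (0 < n)%N -> exists z : k, n.-primitive_root z.
Proof.
move=> /pcharf0P char0 n_gt0; pose p : {poly k} := 'X^n - 1.
have [r Dp] := closed_field_poly_normal p.
rewrite (monicP _) ?monicXnsubC // scale1r in Dp.
have rn1 : all n.-unity_root r by apply/allP=> z; rewrite -root_prod_XsubC -Dp.
have sz_r : (n < (size r).+1)%N.
  by rewrite -(size_prod_XsubC r id) -Dp size_XnsubC.
have [|z] := hasP (cyclic.has_prim_root n_gt0 rn1 _ sz_r); last by exists z.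
by rewrite -separable_prod_XsubC -Dp separable_Xn_sub_1 // char0 -lt0n.
Qed.

(** * The trace of x |-> a x b on a semisimple algebra, and its positivity *)

Section TracePositivity.
Variables (k : closedFieldType) (A : falgType k).
Hypotheses (char0 : [pchar k] =i pred0) (ssA : semisimple A).

Let natk0 (m : nat) : (m%:R == 0 :> k) = (m == 0%N).
Proof. by move/pcharf0P: char0 => ->. Qed.

Variable s : seq A.
Hypotheses (sP : forall a, a \in s -> primitive_central_idem a)
  (sE : 1 = \sum_(a <- s) a).

Lemma regtr_primitive_neq0 a : a \in s -> regtr a != 0.
Proof.
move=> /sP [[_ aa] a0 _]; have [m [-> m0]] := regtr_idem aa.
by rewrite natk0; apply: contra_neq a0 => /m0.
Qed.

Lemma central_expand z : central z ->
  z = \sum_(a <- s) (regtr (z * a) / regtr a) *: a.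
Proof.
move=> zC; rewrite -[LHS]mulr1 {1}sE mulr_sumr big_seq [RHS]big_seq.
apply: eq_bigr => a a_s; have [c zac] := primitive_central_scalar ssA (sP a_s) zC.
by rewrite zac linearZ /= mulfK // regtr_primitive_neq0.
Qed.

(** As a function of b the trace is a trace function, hence regtr( . w) with w central. Expanding w
    on the blocks leaves its values at e, where e commutes past x and gives regtr(a e). *)
Lemma trace_lrmul a b : trace (fun x => a * x * b) =
  \sum_(e <- s) regtr (a * e) * regtr (b * e) / regtr e.
Proof.
pose phi c := trace (fun x => a * x * c).
have phil : scalar phi by apply: trace_linear; lin.
have phiC x y : phi (x * y) = phi (y * x).
  rewrite /phi; under eq_trace => z do rewrite [_ * (x * y)]mulrA.
  rewrite (trace_comp (f := fun z => z * y) (g := fun z => a * z * x)); try by lin.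
  by apply: eq_trace => z; rewrite !mulrA.
have [w wP] : exists w, forall x, phi x = regtr (x * w).
  apply: (@nondegenerate_repr _ A (fun x w => regtr (x * w))) => //; try by lin.
  by move=> y; apply: regtr_nondegenerate.
have wC : central w.
  move=> x; apply/eqP; rewrite -subr_eq0; apply/eqP/(regtr_nondegenerate ssA char0) => y.
  rewrite mulrBr linearB /= !mulrA -wP.
  by rewrite [regtr (y * w * x)]regtrC mulrA -wP phiC subrr.
rewrite -[LHS]/(phi b) wP (central_expand wC) mulr_sumr linear_sum /=.
rewrite big_seq [RHS]big_seq; apply: eq_bigr => e e_s.
rewrite -scalerAr linearZ /= mulrAC; congr (_ * _ / _).
rewrite regtrC -wP /phi /regtr; apply: eq_trace => x.
have [[eC _] _ _] := sP e_s.
by rewrite -mulrA eC mulrA.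
Qed.

Variables (v : A) (n : nat).
Hypotheses (n_gt0 : (0 < n)%N) (vn : v ^+ n = 1).

Section EigenProjections.
Variables (z : k) (zP : n.-primitive_root z).

Let nk0 : n%:R != 0 :> k. Proof. by rewrite natk0 -lt0n. Qed.
Let z0 : z != 0.
Proof.
apply/eqP => zz; have := prim_expr_order zP.
by rewrite zz expr0n gtn_eqF // => /esym/eqP; rewrite oner_eq0.
Qed.

(** The spectral projection of v for the eigenvalue z^j, as a discrete Fourier sum of the powers of
    v. *)
Definition eigenproj (j : nat) : A :=
  n%:R^-1 *: \sum_(l < n) ((z ^- j) *: v) ^+ l.

Lemma mulr_eigenproj j : v * eigenproj j = z ^+ j *: eigenproj j.
Proof.
have zj0 : z ^+ j != 0 by rewrite expf_neq0.
pose a := z ^- j *: v.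
have -> : v = z ^+ j *: a by rewrite /a scalerA divff // scale1r.
rewrite -scalerAl; congr (_ *: _); rewrite /eigenproj -/a -scalerAr; congr (_ *: _).
have an : a ^+ n = 1.
  rewrite /a exprZn vn exprVn -exprM mulnC exprM (prim_expr_order zP).
  by rewrite expr1n invr1 scale1r.
rewrite mulr_sumr; under eq_bigr => l _ do rewrite -exprS.
case: n n_gt0 an => // m _ am.
by rewrite [LHS]big_ord_recr [RHS]big_ord_recl /= addrC am expr0.
Qed.

Lemma eigenproj_idem j : eigenproj j * eigenproj j = eigenproj j.
Proof.
rewrite {1}/eigenproj -scalerAl mulr_suml.
rewrite (eq_bigr (fun=> eigenproj j)) => [|l _].
  by rewrite sumr_const card_ord -scaler_nat scalerA mulVf // scale1r.
elim: (nat_of_ord l) => [|i IHi]; first by rewrite mul1r.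
rewrite exprS -mulrA IHi -scalerAl mulr_eigenproj scalerA mulVf ?scale1r //.
by rewrite expf_neq0.
Qed.

Lemma sum_eigenproj : \sum_(j < n) eigenproj j = 1.
Proof.
rewrite /eigenproj -scaler_sumr exchange_big /=.
transitivity (n%:R^-1 *: (n%:R *: (1 : A))); last by rewrite scalerA mulVf // scale1r.
congr (_ *: _); rewrite (bigD1 (Ordinal n_gt0)) //= [X in _ + X]big1 => [|l l0].
  by rewrite (eq_bigr (fun=> 1)) // sumr_const card_ord scaler_nat addr0.
under eq_bigr => j _ do rewrite exprZn -exprVn -exprM mulnC exprM.
rewrite -scaler_suml; set y := z^-1 ^+ l.
suff -> : \sum_(j < n) y ^+ j = 0 by rewrite scale0r.
have y1 : y - 1 != 0.
  rewrite subr_eq0 /y exprVn invr_eq1 -(prim_order_dvd zP).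
  by apply: contra_neqN l0 => /dvdnP [[|q] lE]; apply: val_inj; rewrite /= lE // mulSn;
    have := ltn_ord l; rewrite lE mulSn ltnNge leq_addr.
apply: (mulfI y1); rewrite mulr0 -subrX1 /y -exprM mulnC exprM exprVn.
by rewrite (prim_expr_order zP) invr1 expr1n subrr.
Qed.

Lemma regtr_eigen e : regtr (v * e) = \sum_(j < n) regtr (eigenproj j * e) * z ^+ j.
Proof.
rewrite -{1}[v]mulr1 -sum_eigenproj mulr_sumr mulr_suml linear_sum.
by apply: eq_bigr => j _; rewrite mulr_eigenproj -scalerAl linearZ /= mulrC.
Qed.

(** v^(n-1) is the inverse of v, and z^-j is written z^(n-j) so that the expansion is a polynomial
    in z. *)
Lemma regtr_eigen_inv e :
  regtr (v ^+ n.-1 * e) = \sum_(j < n) regtr (eigenproj j * e) * z ^+ (n - j).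
Proof.
rewrite -{1}[v ^+ n.-1]mulr1 -sum_eigenproj mulr_sumr mulr_suml linear_sum.
apply: eq_bigr => j _; rewrite [RHS]mulrC -[RHS]linearZ scalerAl; congr (regtr (_ * e)).
have E : eigenproj j = z ^+ (n - j) *: (v * eigenproj j).
  rewrite mulr_eigenproj scalerA -exprD subnK ?(prim_expr_order zP) ?scale1r //.
  exact: ltnW.
by rewrite [in LHS]E -scalerAr mulrA -exprSr prednK // vn mul1r.
Qed.

End EigenProjections.

(** If the trace is 0 then so is every regtr(v e). Up to a positive integer, the trace is an integer
    polynomial in z whose e-term, read at a complex root of unity, is a positive multiple of a
    squared modulus. *)
Lemma trace_conj_neq0 c : central c -> regtr (v * c) != 0 ->
  trace (fun x => v * x * v ^+ n.-1) != 0.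
Proof.
move=> cC; apply: contra_neq => tr0.
have [z zP] := closed_prim_root_exists char0 n_gt0.
have [w wP] := C_prim_root_exists n_gt0.
(* An eigenprojection times a central idempotent is idempotent, so its regular trace is a natural
   number; 0 is a filler outside [s]. *)
have [m mE] : exists m : A * nat -> nat, forall ej, ej.1 \in s ->
    regtr (eigenproj z ej.2 * ej.1) = (m ej)%:R.
  suff /choice [m mP] : forall ej : A * nat, exists m : nat, ej.1 \in s ->
      regtr (eigenproj z ej.2 * ej.1) = m%:R by exists m.
  case=> e j /=; have [e_s|] := boolP (e \in s); last by exists 0%N.
  have [[eC ee] _ _] := sP e_s.
  have [|l [lE _]] := @regtr_idem _ _ (eigenproj z j * e); last by exists l.
  by rewrite mulrA -[_ * e * _]mulrA -eC mulrA eigenproj_idem // -mulrA ee.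
have [d dE] : exists d : A -> nat, forall e, e \in s -> regtr e = (d e)%:R.
  suff /choice [d dP] : forall e : A, exists d : nat, e \in s -> regtr e = d%:R by exists d.
  move=> e; have [e_s|] := boolP (e \in s); last by exists 0%N.
  have [[eC ee] _ _] := sP e_s.
  by have [l [lE _]] := regtr_idem ee; exists l.
have d_gt0 e : e \in s -> (0 < d e)%N.
  by move=> e_s; have := regtr_primitive_neq0 e_s; rewrite dE // natk0 lt0n.
(* [D] clears the denominators regtr(e) = [d e], leaving the integer weights [D' e]. *)
pose D := (\prod_(e <- s) d e)%N; pose D' e := (D %/ d e)%N.
have D_gt0 : (0 < D)%N by rewrite /D big_seq prodn_cond_gt0.
have dvdD e : e \in s -> (d e %| D)%N.
  by move=> e_s; rewrite /D (big_rem e e_s) dvdn_mulr.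
pose P (f : nat -> nat) e : {poly int} := \sum_(j < n) (m (e, val j))%:Z *: 'X^(f j).
have PE (K : fieldType) f e (y : K) :
    (map_poly (intr : int -> K) (P f e)).[y] = \sum_(j < n) (m (e, val j))%:R * y ^+ f j.
  rewrite rmorph_sum horner_sum; apply: eq_bigr => j _.
  by rewrite /= map_polyZ map_polyXn !hornerE.
pose Q : {poly int} := \sum_(e <- s) (D' e)%:Z *: (P id e * P (subn n) e).
have QE (K : fieldType) (y : K) : (map_poly (intr : int -> K) Q).[y] =
    \sum_(e <- s) (D' e)%:R * ((map_poly (intr : int -> K) (P id e)).[y] *
       (map_poly (intr : int -> K) (P (subn n) e)).[y]).
  rewrite rmorph_sum horner_sum; apply: eq_bigr => e _.
  by rewrite /= map_polyZ rmorphM hornerZ hornerM.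
have Pz e : e \in s -> regtr (v * e) = (map_poly (intr : int -> k) (P id e)).[z].
  by move=> e_s; rewrite PE (regtr_eigen zP); apply: eq_bigr => j _; rewrite (mE (e, val j)).
have Q0 : (map_poly (intr : int -> k) Q).[z] = 0.
  transitivity (D%:R * trace (fun x => v * x * v ^+ n.-1)); last by rewrite tr0 mulr0.
  rewrite QE trace_lrmul mulr_sumr.
  rewrite big_seq [RHS]big_seq; apply: eq_bigr => e e_s.
  rewrite /D' pchar0_natf_div ?dvdD // -dE // mulrAC -mulrA; congr (_ * (_ / _)).
  rewrite -Pz // PE (regtr_eigen_inv zP); congr (_ * _).
  by apply: eq_bigr => j _; rewrite (mE (e, val j)).
(* Vanishing at z transfers to w. There conjugation inverts w, so each summand is [D' e] times the
   squared modulus of [P id e] at w, and all of them vanish. *)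
have Pw : forall e, e \in s -> (map_poly (intr : int -> algC) (P id e)).[w] = 0.
  have := (prim_root_evalP n_gt0 char0 zP Q).1 Q0.
  move/(prim_root_evalP n_gt0 Cpchar wP Q).2; rewrite QE.
  have w1 : `|w| = 1.
    apply/eqP; rewrite -(pexpr_eq1 n_gt0) ?normr_ge0 //.
    by rewrite -normrX (prim_expr_order wP) normr1.
  have wC : w^* = w^-1 by rewrite invC_norm w1 expr1n invr1 mul1r.
  have w0 : w != 0 by rewrite -normr_eq0 w1 oner_eq0.
  have conjP e : (map_poly (intr : int -> algC) (P (subn n) e)).[w] =
      ((map_poly (intr : int -> algC) (P id e)).[w])^*.
    rewrite !PE rmorph_sum; apply: eq_bigr => j _ /=.
    rewrite rmorphM rmorphXn /= conjC_nat wC; congr (_ * _).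
    apply: (mulIf (expf_neq0 j w0)); rewrite -exprD subnK ?(ltnW (ltn_ord j)) //.
    by rewrite (prim_expr_order wP) -exprMn mulVf // expr1n.
  move/eqP; rewrite psumr_eq0 => [/allP Qe e e_s|e _]; last first.
    by rewrite conjP mulr_ge0 ?ler0n ?mul_conjC_ge0.
  have := Qe e e_s; rewrite /= conjP mulf_eq0 mul_conjC_eq0 pnatr_eq0.
  rewrite /D' -leqn0 leqNgt divn_gt0 ?d_gt0 // dvdn_leq ?dvdD //.
  by move/eqP.
rewrite (central_expand cC) mulr_sumr linear_sum big_seq big1 //= => e e_s.
rewrite -scalerAr linearZ /= Pz //.
have /(prim_root_evalP n_gt0 Cpchar wP) := Pw e e_s.
by move=> /(prim_root_evalP n_gt0 char0 zP) ->; rewrite mulr0.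
Qed.
End TracePositivity.

(** * Non-vanishing of the trace of the square of the antipode *)

Section GrouplikeOrder.
Variables (k : fieldType) (H : falgType k) (hH : hopf H) (g g' : H).
Hypotheses (gg' : g * g' = 1)
  (gD : forall (X : lmodType k) (b : H -> H -> X),
     (forall y, linear (b^~ y)) -> (forall x, linear (b x)) ->
     tlift b (comul hH g) = b g g).

Lemma grouplike_exp i (X : lmodType k) (b : H -> H -> X) :
  (forall y, linear (b^~ y)) -> (forall x, linear (b x)) ->
  tlift b (comul hH (g ^+ i)) = b (g ^+ i) (g ^+ i).
Proof.
elim: i X b => [|i IHi] X b bl br; first by rewrite comul1E.
rewrite exprS comulME // gD; try by lin.
by rewrite IHi //; lin.
Qed.

(** Distinct grouplikes are linearly independent, so finite dimension forces a repetition among the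
    powers of g, which [g'] allows to cancel. *)
Lemma grouplike_finite_order : exists2 n, (0 < n)%N & g ^+ n = 1.
Proof.
have g_reg i x y : x * g ^+ i = y * g ^+ i -> x = y.
  elim: i x y => [|i IHi] x y; first by rewrite !mulr1.
  rewrite !exprS !mulrA => /IHi /(f_equal (fun z => z * g')).
  by rewrite -!mulrA gg' !mulr1.
suff [m [i im gm]] : exists m, exists2 i, (i < m)%N & g ^+ m = g ^+ i.
  exists (m - i)%N; first by rewrite subn_gt0.
  by apply: (g_reg i); rewrite -exprD subnK ?mul1r // ltnW.
pose L := nat_rect (fun _ => seq H) [::] (fun i s => g ^+ i :: s).
have sizeL m : size (L m) = m by elim: m => //= m ->.
have inL m x : x \in L m -> exists2 i, (i < m)%N & x = g ^+ i.
  elim: m => //= m IHm; rewrite inE => /orP [/eqP ->|/IHm [i im ->]].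
    by exists m.
  by exists i => //; apply: ltnW.
have exL : exists m, ~~ free (L m).
  exists (\dim {: H}).+1; rewrite /free sizeL neq_ltn.
  by rewrite ltnS dimvS ?subvf.
have [[|m]] := ex_minnP exL; first by rewrite nil_free.
rewrite /= free_cons negb_and negbK => gL Lmin; exists m.
have Lfree : free (L m) by apply: contraT => /Lmin; rewrite ltnn.
rewrite Lfree orbF in gL; pose X := in_tuple (L m).
have gE : g ^+ m = \sum_i coord X i (g ^+ m) *: X`_i by apply: coord_span.
have [i0 ci0] : exists i, coord X i (g ^+ m) != 0.
  apply: contrapT => /forallNP c0; have := g_reg m 1 0; rewrite mul1r mul0r {1}gE.
  rewrite big1 => [/(_ erefl)/eqP|i _]; first by rewrite oner_eq0.
  by have /negP := c0 i; rewrite negbK => /eqP ->; rewrite scale0r.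
have XE (i : 'I_(size (L m))) : exists2 j, (j < m)%N & X`_i = g ^+ j.
  by apply: inL; rewrite mem_nth // sizeL ?ltn_ord.
(* Contracting one leg with a coordinate form acts on each power of g by a scalar. On the relation
   [gE] it keeps only the i0-term, so g^m equals that earlier power. *)
pose F h := tlift (fun x y => coord X i0 x *: y) (comul hH h).
have Fl : linear F by rewrite /F; lin.
have FE j : F (g ^+ j) = coord X i0 (g ^+ j) *: g ^+ j.
  by rewrite /F grouplike_exp //; lin.
have [j jm XjE] := XE i0; exists j => //; rewrite -XjE.
have FX (i : 'I_(size (L m))) : F X`_i = (i == i0)%:R *: X`_i.
  by have [l _ XlE] := XE i; rewrite XlE FE -XlE coord_free.
apply: (scalerI ci0); rewrite -FE {1}gE linear_fun_sum // (bigD1 i0) //=.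
rewrite FX eqxx scale1r big1 ?addr0 // => i ii0.
by rewrite FX (negPf ii0) scale0r scaler0.
Qed.
End GrouplikeOrder.

Section TraceNonzero.
Variables (k : closedFieldType) (H : falgType k) (hH : hopf H).
Hypotheses (char0 : [pchar k] =i pred0) (ssH : semisimple H).

Notation S := (antipode hH).
Notation eps := (counit hH).
Notation t := (trint hH).

(* Radford's formula expresses S^4 as conjugation by a grouplike, so after     *)
(* rescaling on the blocks, S^2 is conjugation by an element of finite order.  *)
Lemma antipode2_inner : exists v n,
  [/\ (0 < n)%N, v ^+ n = 1 & forall x, S (S x) = v * x * v ^+ n.-1].
Proof.
have [Lam [epsL LamL LamR]] := semisimple_integral hH ssH.
have rnd := regtr_nondegenerate ssH char0.
have tnd := trint_nondegr epsL LamR.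
(* [u] links the two nondegenerate forms. The regular trace is symmetric while t has Nakayama
   automorphism S^2, so S^2 is conjugation by [u]. *)
have [u uE] : exists u, forall x, t x = regtr (x * u).
  apply: (@nondegenerate_repr _ H (fun x w => regtr (x * w))); try by lin.
  by move=> y; apply: rnd.
have [w wE] : exists w, forall x, regtr x = t (x * w).
  apply: (@nondegenerate_repr _ H (fun x w => t (x * w))); try by lin.
  by move=> y; apply: tnd.
have wu : w * u = 1.
  apply/eqP; rewrite -subr_eq0; apply/eqP/rnd => x.
  by rewrite mulrBr linearB /= mulr1 mulrA -uE -wE subrr.
have uw : u * w = 1.
  apply/eqP; rewrite -subr_eq0; apply/eqP/tnd => x.
  by rewrite mulrBr linearB /= mulr1 mulrA -wE -uE subrr.
have uS x : u * x = S (S x) * u.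
  apply/eqP; rewrite -subr_eq0; apply/eqP/rnd => y.
  by rewrite mulrBr linearB /= !mulrA [regtr (y * u * x)]regtrC mulrA -!uE trint_antipode2 subrr.
have S2E x : S (S x) = u * x * w by rewrite uS -mulrA uw mulr1.
pose gam := dist_grouplike hH Lam; pose gam' := S gam.
have gg' : gam * gam' = 1 by apply: antipode_gammar.
have g'g : gam' * gam = 1 by apply: antipode_gammal.
(* Both u^2 and gam' implement S^4 by conjugation, so u^-2 gam' is central. *)
pose q := w * w * gam'.
have qC : central q.
  move=> x; have := antipode4 epsL LamR x; rewrite -/gam !S2E => E.
  have -> : q * x = q * (x * gam) * gam' by rewrite -!mulrA gg' mulr1.
  rewrite E /q !mulrA -[w * w * gam' * gam]mulrA g'g mulr1.
  by rewrite -[w * w * u]mulrA wu mulr1 wu mul1r.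
have [s [sP [s_uniq s_orth] sE]] : exists s : seq H, _ :=
  central_idem_decomp (conj (fun x => etrans (mulr1 x) (esym (mul1r x))) (mul1r 1)).
have {}sP a : a \in s -> primitive_central_idem a by case/sP.
(* Square roots of the scalars by which q acts on the blocks; they assemble to a central square root
   [r] of q. *)
have [rho rhoE] : exists rho : H -> k, forall a, rho a ^+ 2 = regtr (q * a) / regtr a.
  suff /choice [f fP] : forall a : H, exists y : k, y ^+ 2 = regtr (q * a) / regtr a by exists f.
  move=> a; set c := _ / _.
  have /closed_rootP [y] : size ('X^2 - c%:P : {poly k}) != 1%N by rewrite size_XnsubC.
  by rewrite /root !hornerE subr_eq0 => /eqP; exists y.
pose r := \sum_(a <- s) rho a *: a.
have rr : r * r = q.
  rewrite {1}/r mulr_suml (central_expand char0 ssH sP sE qC) big_seq [RHS]big_seq.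
  apply: eq_bigr => a a_s; rewrite -rhoE expr2 -scalerA -scalerAl; congr (_ *: _).
  rewrite /r mulr_sumr (bigD1_seq a) //= big_seq_cond big1 ?addr0 => [|b /andP[b_s ba]].
    by have [[_ aa] _ _] := sP a a_s; rewrite -scalerAr aa.
  by rewrite -scalerAr s_orth // 1?eq_sym // scaler0.
have rC : central r.
  move=> x; rewrite /r mulr_sumr mulr_suml big_seq [RHS]big_seq.
  apply: eq_bigr => a a_s; have [[aC _] _ _] := sP a a_s.
  by rewrite -scalerAr -scalerAl aC.
(* [v] still implements S^2, and v^2 = q u^2 = gam' has finite order. *)
pose v := r * u.
have vv : v * v = gam'.
  rewrite /v mulrA -[r * u * r]mulrA rC !mulrA rr -[q * u]qC -mulrA -qC /q !mulrA.
  by rewrite -[u * u * w]mulrA uw mulr1 uw mul1r.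
have vS x : v * x = S (S x) * v.
  by rewrite /v -mulrA uS mulrA -rC !mulrA.
have [N N0 gN] := grouplike_finite_order gg'
  (fun X b bl br => gamma_grouplike epsL LamR bl br).
have g'N : gam' ^+ N = 1.
  rewrite -[LHS]mulr1 -gN -exprMn_comm ?g'g ?expr1n //.
  by rewrite /GRing.comm gg' g'g.
exists v, (2 * N)%N; have vN : v ^+ (2 * N) = 1 by rewrite exprM expr2 vv.
have N2 : (0 < 2 * N)%N by rewrite muln_gt0.
by split=> // x; rewrite vS -mulrA -exprS prednK // vN mulr1.
Qed.

(** The central element to test is [Lam]: v Lam = eps(v) Lam with eps(v) a root of unity, and
    multiplication by Lam has rank one and trace eps(Lam) = 1. *)
Lemma trint1_neq0 : t 1 != 0.
Proof.
have [v [n [n0 vn vS]]] := antipode2_inner.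
have [Lam [epsL LamL LamR]] := semisimple_integral hH ssH.
have [s [sP _ sE]] : exists s : seq H, _ :=
  central_idem_decomp (conj (fun x => etrans (mulr1 x) (esym (mul1r x))) (mul1r 1)).
have {}sP a : a \in s -> primitive_central_idem a by case/sP.
rewrite /trint; under eq_trace => x do rewrite mul1r vS.
apply: (trace_conj_neq0 char0 ssH sP sE n0 vn (c := Lam)).
  by move=> x; rewrite LamL LamR.
have epsv : eps v != 0.
  apply: contra_eq_neq (f_equal eps vn) => v0.
  by rewrite -(prednK n0) exprS counitM v0 mul0r counit1 eq_sym oner_eq0.
rewrite LamL linearZ /= mulf_neq0 // /regtr.
under eq_trace => x do rewrite LamR.
by rewrite trace_rank1 ?epsL ?oner_neq0 //; lin.
Qed.

End TraceNonzero.

(** * Complements of subcoalgebras *)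

Lemma tlift_mem (k : fieldType) (U V X : vectType k) (b : U -> V -> X)
    (W : {vspace X}) t : (forall x y, b x y \in W) -> tlift b t \in W.
Proof. by move=> bW; apply: memv_suml => i _; apply: memv_suml => j _; apply: memvZ. Qed.

Section TensorSubspaces.
Variables (k : fieldType) (U V : vectType k) (B : {vspace U}) (C : {vspace V}).

Lemma mem_tensv b c : b \in B -> c \in C -> tens b c \in tensv B C.
Proof. by move=> bB cC; apply: mem_span_set; exists b, c. Qed.

Lemma tensv_tlift (X : vectType k) (f : U -> V -> X) (W : {vspace X}) t :
  (forall y, linear (f^~ y)) -> (forall x, linear (f x)) ->
  (forall b c, b \in B -> c \in C -> f b c \in W) ->
  t \in tensv B C -> tlift f t \in W.
Proof.
move=> fl fr fW tBC; have : t \in (linfun (tlift f) @^-1: W)%VS.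
  apply: (subvP _ t tBC); apply: span_set_sub => _ [b [c [bB cC ->]]].
  by rewrite -memv_preim lfunE /= tlift_tens // fW.
by rewrite -memv_preim lfunE.
Qed.

Lemma eq_tensv_tlift (X : vectType k) (f g : U -> V -> X) t :
  (forall y, linear (f^~ y)) -> (forall x, linear (f x)) ->
  (forall y, linear (g^~ y)) -> (forall x, linear (g x)) ->
  (forall b c, b \in B -> c \in C -> f b c = g b c) ->
  t \in tensv B C -> tlift f t = tlift g t.
Proof.
move=> fl fr gl gr fg tBC; apply/eqP; rewrite -subr_eq0 -memv0.
rewrite -tliftB; apply: tensv_tlift tBC => [y|x|b c bB cC].
- by apply: linear_add => //; apply: linear_opp.
- by apply: linear_add => //; apply: linear_opp.
by rewrite fg // subrr mem0v.
Qed.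

End TensorSubspaces.

Lemma tensvS (k : fieldType) (U V : vectType k) (B B' : {vspace U})
    (C C' : {vspace V}) :
  (B <= B')%VS -> (C <= C')%VS -> (tensv B C <= tensv B' C')%VS.
Proof.
move=> /subvP BB' /subvP CC'; apply: span_set_sub => _ [b [c [/BB' bB /CC' cC ->]]].
exact: mem_tensv.
Qed.

Section SubcoalgebraComplement.
Variables (k : fieldType) (H : falgType k) (hH : hopf H) (lam : {scalar H}).

Notation S := (antipode hH).
Notation eps := (counit hH).
Notation Delta := (comul hH).

Hypotheses (lam1 : lam 1 = 1)
  (lam_integral : forall (X : lmodType k) (f : H -> X) h, linear f ->
     tlift (fun x y => lam y *: f x) (Delta h) = lam h *: f 1).

Let omega x y : k := lam (x * S y).

(** Invariance of lam at x S(y_1) produces the first leg x_1 S(y_2) y_3, where the antipode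
    cancels. *)
Lemma omega_balanced (X : lmodType k) (f : H -> X) x y : linear f ->
  tlift (fun x1 x2 => omega x2 y *: f x1) (Delta x) =
  tlift (fun y1 y2 => omega x y1 *: f y2) (Delta y).
Proof.
move=> fl; symmetry; rewrite /omega.
transitivity (tlift (fun y1 y2 => tlift (fun a b => tlift (fun x1 x2 =>
   lam (x2 * S a) *: f (x1 * (S b * y2))) (Delta x)) (Delta y1)) (Delta y)).
  apply: eq_tlift => y1 y2.
  have := @lam_integral _ (fun z => f (z * y2)) (x * S y1); rewrite mul1r => <-;
    last by lin.
  rewrite comulME; try by lin.
  rewrite (tlift_exchange (fun x1 x2 a b => _)).
  rewrite comul_antipodeE; try by lin.
  by apply: eq_tlift => a b; apply: eq_tlift => x1 x2; rewrite mulrA.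
rewrite (coassoc hH (fun a b y2 => _)).
rewrite -[RHS](@counitrE _ _ hH _ (fun z => tlift (fun x1 x2 => lam (x2 * S z) *: f x1) (Delta x)));
  last by lin.
apply: eq_tlift => a r.
rewrite (@antipodelE _ _ hH _
    (fun z => tlift (fun x1 x2 => lam (x2 * S a) *: f (x1 * z)) (Delta x)));
  last by lin.
by congr (_ *: _); apply: eq_tlift => x1 x2; rewrite mulr1.
Qed.

Lemma omega_counit h :
  tlift (fun x y => omega x y : k^o) (Delta h) = eps h.
Proof.
by rewrite (@antipoderE _ _ hH k^o lam) ?lam1 ?[_ *: _]mulr1 //; lin.
Qed.

Lemma omega_linearl y : scalar (omega^~ y).
Proof. by rewrite /omega; lin. Qed.

Lemma omega_linearr x : scalar (omega x).
Proof. by rewrite /omega; lin. Qed.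

Section Complement.
Variables (D : {vspace H}) (scD : subcoalgebra hH D).

Let p := projv D.
Let pD x : p x \in D. Proof. exact: memv_proj. Qed.
Let pid x : x \in D -> p x = x. Proof. exact: projv_id. Qed.

(** Averages of the linear projection [p] by the integral; [Q] and [Q'] are the convolutions by
    these functionals on the two sides. *)
Let E h : k := tlift (fun x y => omega x (p y) : k^o) (Delta h).
Let E' h : k := tlift (fun x y => omega (p x) y : k^o) (Delta h).

Let El : scalar E.
Proof. by move=> a u v; rewrite /E linearP linearP. Qed.
Let E'l : scalar E'.
Proof. by move=> a u v; rewrite /E' linearP linearP. Qed.

Let Q h := tlift (fun x y => E y *: x) (Delta h).
Let Q' h := tlift (fun x y => E' x *: y) (Delta h).

Let Ql : linear Q. Proof. by rewrite /Q; lin. Qed.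
Let Q'l : linear Q'. Proof. by rewrite /Q'; lin. Qed.

(** By [omega_balanced], Q h is a combination of second legs of Delta(p(h_2)), which lie in the
    subcoalgebra D. *)
Let QD h : Q h \in D.
Proof.
have -> : Q h = tlift (fun r b => tlift (fun c d => omega r c *: d) (Delta (p b))) (Delta h).
  transitivity (tlift (fun x y => tlift (fun a b => omega a (p b) *: x) (Delta y)) (Delta h)).
    by apply: eq_tlift => x y; rewrite (tlift_linear (f := fun c : k^o => (c : k) *: x)) //; lin.
  rewrite -(coassoc hH (fun x a b => _)); apply: eq_tlift => r b.
  by rewrite (@omega_balanced _ id).
apply: tlift_mem => r b; apply: tensv_tlift (scD (pD b)).
- by move=> y; apply: linear_scaler; apply: omega_linearr.
- by lin.
by move=> c d _ dD; apply: memvZ.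
Qed.

Let Q'D h : Q' h \in D.
Proof.
have -> : Q' h = tlift (fun a r => tlift (fun c d => omega d r *: c) (Delta (p a))) (Delta h).
  transitivity (tlift (fun x y => tlift (fun a b => omega (p a) b *: y) (Delta x)) (Delta h)).
    by apply: eq_tlift => x y; rewrite (tlift_linear (f := fun c : k^o => (c : k) *: y)) //; lin.
  rewrite (coassoc hH (fun x a b => _)); apply: eq_tlift => a r.
  by rewrite (@omega_balanced _ id).
apply: tlift_mem => a r; apply: tensv_tlift (scD (pD a)).
- by lin.
- by move=> y; apply: linear_scaler; apply: omega_linearl.
by move=> c d cD _; apply: memvZ.
Qed.

Let ED h : h \in D -> E h = eps h.
Proof.
move=> hD; rewrite -omega_counit /E.
apply: (@eq_tensv_tlift _ _ _ D D k^o) (scD hD) => [y|x|y|x|b c bD cD]; last by rewrite pid.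
- exact: omega_linearl.
- by apply: (linear_comp (g := omega x)); [apply: omega_linearr | lin].
- exact: omega_linearl.
- exact: omega_linearr.
Qed.

Let E'D h : h \in D -> E' h = eps h.
Proof.
move=> hD; rewrite -omega_counit /E'.
apply: (@eq_tensv_tlift _ _ _ D D k^o) (scD hD) => [y|x|y|x|b c bD cD]; last by rewrite pid.
- by apply: (linear_comp (g := omega^~ y)); [apply: omega_linearl | lin].
- exact: omega_linearr.
- exact: omega_linearl.
- exact: omega_linearr.
Qed.

Let Qid h : h \in D -> Q h = h.
Proof.
move=> hD; rewrite -[RHS](@counitrE _ _ hH _ id) // /Q.
apply: (eq_tensv_tlift (B := D) (C := D)) (scD hD) => [y|x|y|x|b c bD cD]; last by rewrite ED.
all: by lin.
Qed.

Let Q'id h : h \in D -> Q' h = h.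
Proof.
move=> hD; rewrite -[RHS](@counitlE _ _ hH _ id) // /Q'.
apply: (eq_tensv_tlift (B := D) (C := D)) (scD hD) => [y|x|y|x|b c bD cD]; last by rewrite E'D.
all: by lin.
Qed.

Let EE' h : E h = E' h.
Proof.
have -> : E h = E' (Q h).
  rewrite E'D // /Q (@tlift_linear _ _ _ _ k^o eps); last by lin.
  rewrite -[LHS](@counitlE _ _ hH k^o E) //; apply: (@eq_tlift _ _ _ k^o) => x y.
  by rewrite linearZ /=; exact: mulrC.
have -> : E' h = E (Q' h).
  rewrite ED // /Q' (@tlift_linear _ _ _ _ k^o eps); last by lin.
  rewrite -[LHS](@counitrE _ _ hH k^o E') //; apply: (@eq_tlift _ _ _ k^o) => x y.
  by rewrite linearZ /=; exact: mulrC.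
rewrite /Q /Q' (@tlift_linear _ _ _ _ k^o E') // (@tlift_linear _ _ _ _ k^o E) //.
apply: (@eq_tlift _ _ _ k^o) => x y.
rewrite (@linear_funZ _ _ k^o E') // (@linear_funZ _ _ k^o E) //; exact: mulrC.
Qed.

(** Two projections onto D that commute by coassociativity coincide. Hence Q commutes with Delta on
    both legs ([tensQr], [tensQl]). *)
Let QQ' h : Q h = Q' h.
Proof.
transitivity (Q' (Q h)); first by rewrite Q'id.
transitivity (Q (Q' h)); last by rewrite Qid.
have -> : Q' (Q h) = tlift (fun x y => Q' (E y *: x)) (Delta h) by apply: tlift_linear.
have -> : Q (Q' h) = tlift (fun x y => Q (E' x *: y)) (Delta h) by apply: tlift_linear.
transitivity (tlift (fun x y => tlift (fun a b => (E y * E' a) *: b) (Delta x)) (Delta h)).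
  apply: eq_tlift => x y; rewrite linear_funZ // /Q' tlift_scale.
  by apply: eq_tlift => a b; rewrite scalerA.
rewrite (coassoc hH (fun a b y => _)); apply: eq_tlift => x y.
rewrite linear_funZ // /Q tlift_scale.
by apply: eq_tlift => a b; rewrite scalerA mulrC.
Qed.

Let tensQr h : tlift (fun x y => tens x (Q y)) (Delta h) = Delta (Q h).
Proof.
rewrite /Q (tlift_linear (f := Delta)); last by lin.
transitivity (tlift (fun x y => tlift (fun a b => E b *: tens x a) (Delta y)) (Delta h)).
  apply: eq_tlift => x y; rewrite (tlift_linear (f := tens x)); last exact: tens_linearr.
  by apply: eq_tlift => a b; rewrite (linear_funZ (tens_linearr x)).
rewrite -(coassoc hH (fun x a b => _)); apply: eq_tlift => x y.
by rewrite -tlift_scale -tensor_sum linearZ.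
Qed.

Let tensQl h : tlift (fun x y => tens (Q x) y) (Delta h) = Delta (Q h).
Proof.
rewrite QQ' /Q' (tlift_linear (f := Delta)); last by lin.
transitivity (tlift (fun x y => tlift (fun a b => E' a *: tens b y) (Delta x)) (Delta h)).
  apply: eq_tlift => x y; rewrite QQ' /Q' (tlift_linear (f := fun z => tens z y));
    last by lin.
  by apply: eq_tlift => a b; rewrite (linear_funZ (tens_linearl y)).
rewrite (coassoc hH (fun x a b => _)); apply: eq_tlift => x y.
by rewrite -tlift_scale -tensor_sum linearZ.
Qed.

Lemma subcoalgebra_complement : exists W : {vspace H},
  [/\ subcoalgebra hH W, (D + W)%VS = fullv & (D :&: W)%VS = 0%VS].
Proof.
pose Qf : {linear H -> H} := HB.pack Q
  (GRing.isSemilinear.Build k H H _ Q (GRing.semilinear_linear Ql)).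
pose W := lker (linfun Qf).
have WE x : (x \in W) = (Q x == 0) by rewrite memv_ker lfunE.
have RW x : x - Q x \in W by rewrite WE (linear_funB Ql) (Qid (QD x)) subrr.
exists W; split.
- move=> h; rewrite WE => /eqP Qh.
  (* All terms involving Q factor through Delta(Q h) = 0, so 1 - Q, whose values lie in W, may be
     applied to both legs. *)
  have -> : Delta h = tlift (fun x y => tens (x - Q x) (y - Q y)) (Delta h); last first.
    by apply: tlift_mem => x y; apply: mem_tensv.
  rewrite (eq_tlift (b' := fun x y => tens x y - tens (Q x) y - tens (x - Q x) (Q y))); last first.
    by move=> x y; rewrite -(linear_funB (tens_linearl _)) (linear_funB (tens_linearr _)).
  have -> : tlift (fun x y => tens x y - tens (Q x) y - tens (x - Q x) (Q y)) (Delta h)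
      = Delta h - Delta (Q h) - tlift (fun x y => tens (x - Q x) y) (Delta (Q h)).
    rewrite 2!tliftB -tensor_sum tensQl -tensQr; congr (_ - _).
    rewrite (tlift_linear (f := fun t => tlift (fun x y => tens (x - Q x) y) t));
      last by lin.
    by apply: eq_tlift => x y; rewrite tlift_tens //; lin.
  by rewrite Qh !linear0 !addr0.
- apply/eqP; rewrite eqEsubv subvf; apply/subvP => x _.
  by rewrite -[x](subrK (Q x)) addrC memv_add.
apply/eqP; rewrite -subv0; apply/subvP => x; rewrite memv_cap memv0 WE => /andP [xD].
by rewrite Qid.
Qed.

End Complement.

End SubcoalgebraComplement.

(** * Simple subcoalgebras and the Mackey map *)

Lemma simple_subcoalgebra_exists (k : fieldType) (H : falgType k) (hH : hopf H)
    (W : {vspace H}) : subcoalgebra hH W -> W != 0%VS ->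
  exists2 C, simple_subcoalgebra hH C & (C <= W)%VS.
Proof.
move=> scW W0; pose P n := `[< exists C : {vspace H},
  [/\ subcoalgebra hH C, C != 0%VS, (C <= W)%VS & \dim C = n] >].
have exP : exists n, P n by exists (\dim W); apply/asboolP; exists W.
case: (ex_minnP exP) => n /asboolP [C [scC C0 CW dC]] nmin.
exists C => //; split=> // D scD DC.
have [->|D0] := eqVneq D 0%VS; [by left|right].
apply/eqP; rewrite eqEdim DC dC nmin //; apply/asboolP; exists D; split=> //.
exact: subv_trans CW.
Qed.

(** The span is a subcoalgebra; a nonzero complementary subcoalgebra would contain a simple one,
    which lies in the span as well. The averaging functional is [trint] normalised at 1. *)
Lemma simple_subcoalgebra_span (k : closedFieldType) (H : falgType k)
    (hH : hopf H) : [pchar k] =i pred0 -> semisimple H ->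
  span_set (fun v => exists2 C, simple_subcoalgebra hH C & v \in C) = fullv.
Proof.
move=> char0 ssH; set H0 := span_set _.
have t1 := trint1_neq0 hH char0 ssH.
have simH0 C : simple_subcoalgebra hH C -> (C <= H0)%VS.
  by move=> Cs; apply/subvP => v vC; apply: mem_span_set; exists C.
have scH0 : subcoalgebra hH H0.
  move=> v vH0; have : v \in (linfun (comul hH) @^-1: tensv H0 H0)%VS.
    apply: (subvP _ v vH0); apply: span_set_sub => {vH0} {}v [C Cs vC].
    rewrite -memv_preim lfunE /=; have [scC _ _] := Cs.
    by apply: (subvP (tensvS (simH0 C Cs) (simH0 C Cs))); apply: scC.
  by rewrite -memv_preim lfunE.
pose lam h : k := (trint hH 1)^-1 * trint hH h.
have laml : scalar lam by rewrite /lam; lin.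
pose lamf : {scalar H} := HB.pack lam
  (GRing.isSemilinear.Build k H k _ lam (GRing.semilinear_linear laml)).
have [||W [scW HW dW]] := @subcoalgebra_complement _ _ hH lamf _ _ _ scH0.
- by rewrite /= /lam mulVf.
- move=> X f h fl; rewrite /= /lam -scalerA -trint_integral // tlift_scale.
  by apply: eq_tlift => x y; rewrite scalerA.
have [W0|W0] := eqVneq W 0%VS; first by rewrite -HW W0 addv0.
have [C Cs CW] := simple_subcoalgebra_exists scW W0.
have [_ /eqP []] := Cs; apply/eqP; rewrite -subv0 -dW subv_cap CW andbT.
exact: simH0.
Qed.

Lemma qproj_span_factor (k : fieldType) (V X : vectType k) (P : V -> Prop)
    (F : V -> X) v : linear F -> (forall u, P u -> F u = 0) ->
  F (vsval (qproj (span_set P) v)) = F v.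
Proof.
move=> Fl F0; pose f : {linear V -> X} := HB.pack F
  (GRing.isSemilinear.Build k V X _ F (GRing.semilinear_linear Fl)).
have : v - vsval (qproj (span_set P) v) \in lker (linfun f).
  apply: (subvP _ _ (qproj_repr (span_set P) v)); apply: span_set_sub => u Pu.
  by rewrite memv_ker lfunE /= F0.
by rewrite memv_ker lfunE /= linear_funB // subr_eq0 => /eqP.
Qed.

(** * The Mackey map and its surjectivity *)

Section MackeyMap.
Variables (k : fieldType) (H : falgType k) (hH : hopf H).
Variables (K L : {aspace H}) (M : vectType k) (act : subvs_of K -> M -> M).

Lemma induced_tens_linearl m : linear (fun h => induced_tens act h m).
Proof. by rewrite /induced_tens; lin. Qed.

Lemma induced_tens_linearr h : linear (fun m => induced_tens act h m).
Proof. by rewrite /induced_tens; lin. Qed.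

Lemma induced_tens_balanced h a m :
  induced_tens act (h * vsval a) m = induced_tens act h (act a m).
Proof. by apply/qproj_eq; apply: mem_span_set; exists h, a, m. Qed.

Lemma induced_expand w :
  w = tlift (fun h m => induced_tens act h m)
        (vsval w : tensor H M).
Proof.
rewrite -[LHS]qproj_val [vsval w in LHS]tensor_sum.
by rewrite (tlift_linear (f := qproj _)) //; exact: linear_for_linear.
Qed.

Section Component.
Variable C : {vspace H}.

(** Computed on the chosen representative of the class z; [conjM_mulE] shows that the choice is
    harmless. *)
Definition conjM_mul (l : H) (z : conjM act C) : induced act :=
  tlift (fun (x : subvs_of (C * K)) m => induced_tens act (l * vsval x) m)
    (vsval z : tensor (subvs_of (C * K)) M).

Lemma conjM_mul_linearl z : linear (conjM_mul^~ z).
Proof.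
apply: linear_tlift => x m.
by apply: (linear_comp (induced_tens_linearl m)); lin.
Qed.

Lemma conjM_mul_linearr l : linear (conjM_mul l).
Proof. by rewrite /conjM_mul => a u v; rewrite !linearP. Qed.

Lemma conjM_mulE l x m :
  conjM_mul l (conjM_tens act x m) = induced_tens act (l * vsval x) m.
Proof.
pose b (x : subvs_of (C * K)) m := induced_tens act (l * vsval x) m.
have bl y : linear (b^~ y).
  by apply: (linear_comp (induced_tens_linearl y)); lin.
have br y : linear (b y) by apply: induced_tens_linearr.
rewrite -[RHS](tlift_tens x m bl br).
apply: (qproj_span_factor (F := tlift b)); first exact: tlift_is_linear.
move=> _ [x' [y [a [m' [yE ->]]]]]; rewrite linearB /= !tlift_tens // /b.
by rewrite yE mulrA induced_tens_balanced subrr.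
Qed.

Definition component_map (z : component hH L act C) : induced act :=
  tlift (fun (l : subvs_of L) v => conjM_mul (vsval l) v)
    (vsval z : tensor (subvs_of L) (conjM act C)).

Lemma component_map_linear : linear component_map.
Proof. by rewrite /component_map => a u v; rewrite !linearP. Qed.

Lemma component_mapE l v :
  component_map (component_tens hH l v) = conjM_mul (vsval l) v.
Proof.
pose b (l : subvs_of L) v := conjM_mul (vsval l) v.
have bl y : linear (b^~ y).
  by apply: (linear_comp (conjM_mul_linearl y)); lin.
have br y : linear (b y) by apply: conjM_mul_linearr.
rewrite -[RHS](tlift_tens l v bl br).
apply: (qproj_span_factor (F := tlift b)); first exact: tlift_is_linear.
move=> _ [l' [a [x [y [m [_ yE ->]]]]]]; rewrite linearB /= !tlift_tens // /b.
by rewrite !conjM_mulE yE mulrA subrr.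
Qed.

Lemma component_expand z :
  z = tlift (fun l v => component_tens hH l v)
        (vsval z : tensor (subvs_of L) (conjM act C)).
Proof.
rewrite -[LHS]qproj_val [vsval z in LHS]tensor_sum.
by rewrite (tlift_linear (f := qproj _)) //; exact: linear_for_linear.
Qed.

Lemma component_map_lact l z : 1 \in L ->
  component_map (component_lact l z) = induced_lact l (component_map z).
Proof.
move=> L1; have [il _ _ _] := induced_lactP (L := L) act L1.
have [cl _ _ _] := component_lactP hH L act C.
rewrite (component_expand z) (tlift_linear (f := component_lact l)) //.
rewrite !(tlift_linear (f := component_map)) ?(tlift_linear (f := induced_lact l)) //;
  try exact: component_map_linear.
apply: eq_tlift => l' v; rewrite component_lactE !component_mapE /conjM_mul.
rewrite (tlift_linear (f := induced_lact l)) //; apply: eq_tlift => x m.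
by rewrite induced_lactE mulrA.
Qed.

End Component.

Section Sum.
Variables (I : finType) (C : I -> {vspace H}).

Definition mackey_map (z : dsum (fun i => component hH L act (C i))) :
  induced act := \sum_i component_map (z i).

Lemma mackey_map_linear : linear mackey_map.
Proof.
move=> a u v; rewrite /mackey_map scaler_sumr -big_split; apply: eq_bigr => i _ /=.
by rewrite !ffunE component_map_linear.
Qed.

Lemma mackey_map_in i c :
  mackey_map (dsum_in (fun i => component hH L act (C i)) i c) = component_map c.
Proof.
rewrite /mackey_map (bigD1 i) //= big1 ?addr0 => [|j ji].
  by rewrite ffunE dfwith_in.
by rewrite ffunE dfwith_out 1?eq_sym // /component_map !linear0.
Qed.

(** For fixed m, the h whose tensor with m lies in the image form a subspace, and it contains each
    product l x with x in C_i K. *)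
Lemma mackey_map_surj w : 1 \in L ->
  (\sum_i L * (C i * K))%VS = fullv -> exists z, mackey_map z = w.
Proof.
move=> L1 spanH.
pose f i : 'Hom(component hH L act (C i), induced act) := linfun (@component_map (C i)).
have fE i c : f i c = component_map c.
  pose g : {linear component hH L act (C i) -> induced act} := HB.pack (@component_map (C i))
    (GRing.isSemilinear.Build k _ _ _ _ (GRing.semilinear_linear (@component_map_linear (C i)))).
  exact: (lfunE g).
have : w \in (\sum_i limg (f i))%VS.
  rewrite (induced_expand w); apply: tlift_mem => h m.
  pose g : {linear H -> induced act} := HB.pack (fun h => induced_tens act h m)
    (GRing.isSemilinear.Build k _ _ _ _ (GRing.semilinear_linear (induced_tens_linearl m))).
  suff : h \in (linfun g @^-1: \sum_i limg (f i))%VS by rewrite -memv_preim lfunE.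
  apply: (subvP _ h (memvf h)); rewrite -spanH; apply/subv_sumP => i _.
  apply/prodvP => l x lL xCK; rewrite -memv_preim lfunE /=.
  apply: (subvP (sumv_sup i _ (subvv _))) => //.
  have -> : induced_tens act (l * x) m =
      f i (component_tens hH (vsproj L l) (conjM_tens act (vsproj (C i * K) x) m)).
    by rewrite fE component_mapE conjM_mulE !vsprojK.
  by rewrite memv_img ?memvf.
case/memv_sumP => u uP ->.
have /fin_all_exists [z zP] : forall i, exists c : component hH L act (C i),
    u i = component_map c.
  move=> i; have /memv_imgP [c _ ->] := uP i isT; by exists c; rewrite fE.
exists (finfun z); rewrite /mackey_map; apply: eq_bigr => i _.
by rewrite ffunE zP.
Qed.

End Sum.
End MackeyMap.

Theorem theorem4 (k : closedFieldType) (k_char0 : [pchar k] =i pred0)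
    (H : falgType k) (hH : hopf H) (ssH : semisimple H)
    (K L : {aspace H}) (hK : hopf_subalgebra hH K) (hL : hopf_subalgebra hH L)
    (M : vectType k) (act : subvs_of K -> M -> M) (hM : lmodule_action act)
    (I : finType) (C : I -> {vspace H}) (hC : dcoset_reps hH L K C) :
  exists pi : {linear dsum (fun i => component hH L act (C i)) -> induced act},
  [/\ forall (i : I) (l : subvs_of L) (x : subvs_of (C i * K)) (m : M),
        pi (dsum_in _ i (component_tens hH l (conjM_tens act x m)))
          = induced_tens act (vsval l * vsval x) m,
      forall (l : subvs_of L) z,
        pi (dsum_act (fun i => @component_lact _ _ hH K L M act (C i)) l z)
          = induced_lact l (pi z) &
      forall w : induced act, exists z, pi z = w].
Proof.
have [L1 _ _] := hL; have [_ _ repC] := hC.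
pose pi : {linear dsum (fun i => component hH L act (C i)) -> induced act} :=
  HB.pack (@mackey_map _ _ hH K L M act I C)
    (GRing.isSemilinear.Build k _ _ _ _
      (GRing.semilinear_linear (@mackey_map_linear _ _ hH K L M act I C))).
exists pi; split=> [i l x m|l z|w] /=.
- by rewrite mackey_map_in component_mapE conjM_mulE.
- have [il _ _ _] := induced_lactP (L := L) act L1.
  pose f : {linear induced act -> induced act} := HB.pack (induced_lact l)
    (GRing.isSemilinear.Build k _ _ _ _ (GRing.semilinear_linear (il l))).
  rewrite -[RHS]/(f _) /mackey_map linear_sum; apply: eq_bigr => i _.
  by rewrite ffunE component_map_lact.
apply: mackey_map_surj => //; apply/eqP; rewrite eqEsubv subvf /=.
(* Each simple subcoalgebra lies in some L C_i K, and together they span H. *)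
rewrite -(simple_subcoalgebra_span hH k_char0 ssH); apply: span_set_sub => v [D Ds vD].
have [i DLCK] := repC D Ds; apply: (subvP (sumv_sup i _ (subvv _))) => //.
by rewrite prodvA; apply: (subvP DLCK).
Qed.
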